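(* Let $\mathcal A$ be a trace compatible affine space satisfying the Standing Assumption (stated in the context), let $H_0\in\mathcal A$, $V\in\mathcal A_0$, $H_r=H_0+rV$, and $\lambda\in\Lambda(H_0,V)$. Then the function $r\mapsto S(\lambda;H_r,H_0)$ is a meromorphic function of $r$, which has analytic continuation to all real poles of $(J^{-1}+rT_0(\lambda+i0))^{-1}$.
   Context: Let $\mathcal H$ be a separable complex Hilbert space; $\mathfrak S_p$ ($1\le p<\infty$) are the Schatten ideals, $\mathfrak S_\infty$ is the ideal of compact operators with the operator norm, and $R_z(H)=(H-z)^{-1}$. An affine space $\mathcal A=H+\mathcal A_0$ of self-adjoint operators, where $\mathcal A_0$ is a real linear space of bounded self-adjoint operators, is trace compatible if $V\varphi(H)\in\mathfrak S_1$ for all $H\in\mathcal A$, $V\in\mathcal A_0$, $\varphi\in C_c(\mathbb R)$. With $\mathcal A$ there is associated a fixed open set $\Lambda_{\mathcal A}\subset\mathbb R$. For $H_0\in\mathcal A$, $V\in\mathcal A_0$ write $V=GJG$ with $G=|V|^{1/2}$ and $J=\mathrm{sign}(V)$ (with $J=1$ on $\ker V$, so $J=J^*=J^{-1}$), $T_0(z)=G R_z(H_0)G$ and $B_0(z)=\operatorname{Im}T_0(z)=\frac1{2i}(T_0(z)-T_0(z)^* )$. Standing Assumption (with exponents $1\le\tilde p\le p\le\infty$), required for all $H_0\in\mathcal A$, $V\in\mathcal A_0$: (i) $VR_z(H_0)\in\mathfrak S_p$ for $z\in\mathbb C\setminus\mathbb R$ and $G(1+|H_0|)^{-1/2}\in\mathfrak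 S_{2p}$; (ii) there is an open set $\Lambda=\Lambda(H_0,V)\subset\Lambda_{\mathcal A}$ such that $\Lambda_{\mathcal A}\setminus\Lambda$ is discrete in $\Lambda_{\mathcal A}$ and for all $\lambda\in\Lambda$ the non-tangential norm limits $T_0(\lambda\pm i0)$ exist and belong to $\mathfrak S_\infty$; (iii) $B_0(\lambda\pm i0):=\operatorname{Im}T_0(\lambda\pm i0)\in\mathfrak S_{\tilde p}$ for all $\lambda\in\Lambda$; (iv) if $J^{-1}+T_0(\lambda+i0)$ is not invertible for some $\lambda\in\Lambda$, then $\lambda$ is an eigenvalue of $H_0+V$. Scattering matrix. Let $\mathcal F_0$ be a unitary map of the absolutely continuous subspace of $H_0$ onto a direct integral $\int^\oplus\mathfrak h_\lambda\,d\lambda$ diagonalizing $H_0$, and for $\lambda\in\Lambda(H_0,V)$ let $Z_0(\lambda):\mathcal H\to\mathfrak h_\lambda$ be the bounded operator with $Z_0(\lambda)f=(\mathcal F_0P^{(a)}(H_0)Gf)(\lambda)$ ($P^{(a)}(H_0)$ the projection onto the absolutely continuous subspace), so that $\pi Z_0^*(\lambda)Z_0(\lambda)=B_0(\lambda+i0)$. The scattering matrix of the pair $(H_r,H_0)$ on $\mathfrak h_\lambda$ is given by the stationary formula $$S(\lambda;H_r,H_0)=1-2\pi i\,r\,Z_0(\lambda)J(1+rT_0(\lambda+i0)J)^{-1}Z_0^*(\lambda),$$ whose right-hand side is also used for complex $r$; $S(\lambda;H_r,H_0)$ is unitary for real $r$ such that $1+rT_0(\lambda+i0)J$ is invertible.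 *)

(* Defs.v *)
From HB Require Import structures.
From mathcomp Require Import all_boot all_order all_algebra.
From mathcomp Require Import complex.
From mathcomp Require Import all_classical all_reals all_analysis.

Set Implicit Arguments.
Unset Strict Implicit.
Unset Printing Implicit Defensive.

Import Order.TTheory GRing.Theory Num.Theory.
Import numFieldNormedType.Exports.

Local Open Scope classical_set_scope.
Local Open Scope complex_scope.
Local Open Scope ring_scope.

(* The inner product is linear in its first argument. *)
HB.mixin Record isHilbert (R : realType) H of CompleteNormedModule R[i] H := {
  dotp : H -> H -> R[i];
  dotp_linearl : forall (a : R[i]) (x y z : H),
    dotp (a *: x + y) z = a * dotp x z + dotp y z;
  dotp_conj : forall x y : H, dotp y x = (dotp x y)^*;
  dotp_norm : forall x : H, dotp x x = `|x| ^+ 2 }.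

#[short(type="hilbertType")]
HB.structure Definition Hilbert (R : realType) :=
  { H of isHilbert R H & CompleteNormedModule R[i] H }.

Section BoundedOperators.
Context {R : realType}.

(* Norms in a normed module over R[i] take values in R[i]. *)
Definition rnorm {X : hilbertType R} (x : X) : R := complex.Re `|x|.

Definition bounded_op {X Y : hilbertType R} (T : X -> Y) : Prop :=
  linear T /\ exists c : R, forall x, rnorm (T x) <= c * rnorm x.

Definition invertible_op {X Y : hilbertType R} (T : X -> Y) : Prop :=
  exists S : Y -> X, [/\ bounded_op S, cancel T S & cancel S T].

Definition inv_op {X Y : hilbertType R} (T : X -> Y) (y : Y) : X :=
  xget 0 [set x | T x = y].

Definition adj {X Y : hilbertType R} (T : X -> Y) (y : Y) : X :=
  xget 0 [set z | forall x, dotp (T x) y = dotp x z].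

Definition im_op {X : hilbertType R} (T : X -> X) (x : X) : X :=
  (2 * 'i)^-1 *: (T x - adj T x).

Definition bounded_self_adjoint {X : hilbertType R} (T : X -> X) : Prop :=
  bounded_op T /\ forall x y, dotp (T x) y = dotp x (T y).

Definition orthogonal_projection {X : hilbertType R} (P : X -> X) : Prop :=
  bounded_self_adjoint P /\ forall x, P (P x) = P x.

(* Orthogonal projection onto a closed subspace. *)
Definition proj_onto {X : hilbertType R} (S : set X) (x : X) : X :=
  xget 0 [set y | S y /\ forall z, S z -> dotp (x - y) z = 0].

Definition compact_op {X Y : hilbertType R} (T : X -> Y) : Prop :=
  bounded_op T /\ precompact (T @` [set x | rnorm x <= 1]).

(* [s] lists the eigenvalues of (T^* T)^(1/2) with multiplicities, in
   nonincreasing order and padded with zeros if the rank is finite; the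
   vectors [e n] with [s n != 0] are corresponding orthonormal eigenvectors. *)
Definition singular_values {X Y : hilbertType R} (T : X -> Y) (s : nat -> R) :
    Prop :=
  [/\ forall n, 0 <= s n, nonincreasing_seq s &
    exists e : nat -> X,
    [/\ forall m n, s m != 0 -> s n != 0 -> dotp (e m) (e n) = (m == n)%:R,
        forall n, s n != 0 -> adj T (T (e n)) = (s n ^+ 2)%:C *: e n &
        forall x, (forall n, s n != 0 -> dotp x (e n) = 0) -> T x = 0]].

Definition schatten {X Y : hilbertType R} (p : \bar R) (T : X -> Y) : Prop :=
  match p with
  | r%:E => compact_op T /\ exists s : nat -> R,
      singular_values T s /\ cvgn (series (fun n => s n `^ r))
  | +oo%E => compact_op T
  | -oo%E => False
  end.

End BoundedOperators.

Section UnboundedOperators.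
Context {R : realType} {X : hilbertType R}.

(* Only the values of [uact] on [udom] are meaningful. *)
Record unbounded_op := UnboundedOp { udom : set X; uact : X -> X }.

(* The last clause says that the graph of the adjoint is the graph of H. *)
Definition self_adjoint (H : unbounded_op) : Prop :=
  [/\ dense (udom H),
      forall (a : R[i]) x y, udom H x -> udom H y ->
        udom H (a *: x + y) /\ uact H (a *: x + y) = a *: uact H x + uact H y &
      forall y z, (forall x, udom H x -> dotp (uact H x) y = dotp x z) <->
                  (udom H y /\ uact H y = z)].

Definition of_bounded (V : X -> X) : unbounded_op := UnboundedOp setT V.

Definition uadd (H : unbounded_op) (V : X -> X) : unbounded_op :=
  UnboundedOp (udom H) (fun x => uact H x + V x).

Definition resolvent (H : unbounded_op) (z : R[i]) (x : X) : X :=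
  xget 0 [set y | udom H y /\ uact H y - z *: y = x].

Definition eigenvalue_op (H : unbounded_op) (z : R[i]) : Prop :=
  exists x : X, [/\ x != 0, udom H x & uact H x = z *: x].

(* [mu x] is the scalar measure D |-> <E(D) x, x>. *)
Definition spectral_measure (E : set (measurableTypeR R) -> X -> X)
    (mu : X -> {measure set (measurableTypeR R) -> \bar R}) : Prop :=
  [/\ forall D, measurable D -> orthogonal_projection (E D),
      forall x, E setT x = x,
      forall D1 D2, measurable D1 -> measurable D2 ->
        forall x, E (D1 `&` D2) x = E D1 (E D2 x) &
      forall x D, measurable D -> mu x D = (complex.Re (dotp (E D x) x))%:E].

(* H is the integral of t dE(t). *)
Definition spectral_resolution (H : unbounded_op)
    (E : set (measurableTypeR R) -> X -> X)
    (mu : X -> {measure set (measurableTypeR R) -> \bar R}) : Prop :=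
  [/\ spectral_measure E mu,
      forall x, udom H x <-> (\int[mu x]_t (t ^+ 2)%:E < +oo)%E &
      forall x, udom H x -> dotp (uact H x) x = (\int[mu x]_t t)%:C].

(* B = phi(H): the quadratic form of a bounded operator determines it, since
   the space is complex. *)
Definition functional_calculus (H : unbounded_op) (phi : R -> R[i])
    (B : X -> X) : Prop :=
  bounded_op B /\
  exists E mu, spectral_resolution H E mu /\
    forall x,
    [/\ (mu x).-integrable setT (fun t => (complex.Re (phi t))%:E),
        (mu x).-integrable setT (fun t => (complex.Im (phi t))%:E) &
        dotp (B x) x =
          (\int[mu x]_t complex.Re (phi t)) +i* (\int[mu x]_t complex.Im (phi t))].

Definition ac_subspace (H : unbounded_op) : set X :=
  [set x | exists E mu, spectral_resolution H E mu /\
                        mu x `<< @lebesgue_measure R].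

End UnboundedOperators.

Arguments unbounded_op {R} X.

Section BoundaryValues.
Context {R : realType} {X : hilbertType R}.

Definition T0 (G : X -> X) (H0 : unbounded_op X) (z : R[i]) : X -> X :=
  G \o resolvent H0 z \o G.

(* [L] is the limit in operator norm of [T z] as z tends to [lam] inside any
   cone in the upper ([up = true]) or lower ([up = false]) half-plane. *)
Definition nontangential_limit (T : R[i] -> X -> X) (lam : R) (up : bool)
    (L : X -> X) : Prop :=
  bounded_op L /\
  forall C eps : R, 0 < C -> 0 < eps ->
  exists2 delta : R, 0 < delta &
    forall x y : R, 0 < y < delta -> `|x - lam| <= C * y ->
    forall f, rnorm (T (x +i* (if up then y else - y)) f - L f)
              <= eps * rnorm f.

Definition boundary_value (T : R[i] -> X -> X) (lam : R) (up : bool) : X -> X :=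
  xget (fun=> 0) [set L | nontangential_limit T lam up L].

End BoundaryValues.

Section OperatorValuedFunctions.
Context {R : realType} {X Y : hilbertType R}.
Implicit Types (f g : R[i] -> X -> Y) (D : set R[i]) (c : R[i]).

(* A power series expansion at c, convergent in operator norm. *)
Definition analytic_at f c : Prop :=
  exists a : nat -> X -> Y, (forall k, bounded_op (a k)) /\
  exists2 rho : R, 0 < rho &
    forall r, `|r - c| < rho%:C ->
    forall eps : R, 0 < eps -> exists n0 : nat, forall n, (n0 <= n)%N ->
    forall x, rnorm (f r x - \sum_(k < n) (r - c) ^+ k *: a k x)
              <= eps * rnorm x.

(* In the definitions below, D is the set where the formula for f makes sense;
   the values of f outside D are irrelevant. *)
Definition punctured_eq D f g c : Prop :=
  exists2 rho : R, 0 < rho &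
    forall r, 0 < `|r - c| < rho%:C -> D r /\ forall x, f r x = g r x.

Definition continues_analytically D f c : Prop :=
  exists2 g, analytic_at g c & punctured_eq D f g c.

Definition meromorphic_at D f c : Prop :=
  exists (N : nat) g, analytic_at g c /\
    punctured_eq D f (fun r x => (r - c) ^- N *: g r x) c.

Definition meromorphic D f : Prop :=
  (forall c, D c -> analytic_at f c) /\ (forall c, meromorphic_at D f c).

Definition pole D f c : Prop :=
  meromorphic_at D f c /\ ~ continues_analytically D f c.

End OperatorValuedFunctions.

Section AffineSpaces.
Context {R : realType} {X : hilbertType R}.

Definition abs_sqrt_fun (t : R) : R[i] := (Num.sqrt `|t|)%:C.
Definition sign_fun (t : R) : R[i] := if 0 <= t then 1 else -1.
Definition weight_fun (t : R) : R[i] := ((Num.sqrt (1 + `|t|))^-1)%:C.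

(* G = |V|^(1/2) *)
Definition is_abs_sqrt (V G : X -> X) : Prop :=
  functional_calculus (of_bounded V) abs_sqrt_fun G.

(* J = sign(V), with J = 1 on the kernel of V. *)
Definition is_sign (V J : X -> X) : Prop :=
  functional_calculus (of_bounded V) sign_fun J.

Definition Cc (phi : R -> R[i]) : Prop :=
  [/\ continuous (fun t : R => complex.Re (phi t)),
      continuous (fun t : R => complex.Im (phi t)) &
      exists M : R, forall t, M < `|t| -> phi t = 0].

Definition affine_space (A : set (unbounded_op X)) (A0 : set (X -> X)) : Prop :=
  [/\ A0 (fun=> 0),
      forall (c : R) V W, A0 V -> A0 W -> A0 (fun x => c%:C *: V x + W x),
      forall V, A0 V -> bounded_self_adjoint V &
      exists2 H, self_adjoint H & A = [set uadd H V | V in A0]].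

Definition trace_compatible (A : set (unbounded_op X)) (A0 : set (X -> X)) : Prop :=
  affine_space A A0 /\
  forall H V phi B, A H -> A0 V -> Cc phi -> functional_calculus H phi B ->
    schatten 1%:E (V \o B).

Record standing_assumption (A : set (unbounded_op X)) (A0 : set (X -> X))
    (LamA : set R)
    (Lam : unbounded_op X -> (X -> X) -> set R) (pt p : \bar R) : Prop := {
  sa_exponents : (1%:E <= pt)%E /\ (pt <= p)%E;
  sa_resolvent : forall H0 V z, A H0 -> A0 V -> complex.Im z != 0 ->
    schatten p (V \o resolvent H0 z);
  sa_weight : forall H0 V G W, A H0 -> A0 V -> is_abs_sqrt V G ->
    functional_calculus H0 weight_fun W -> schatten (2%:E * p)%E (G \o W);
  sa_Lam : forall H0 V, A H0 -> A0 V ->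
    [/\ open (Lam H0 V), Lam H0 V `<=` LamA &
        forall lam, LamA lam -> ~ limit_point (LamA `\` Lam H0 V) lam];
  sa_limits : forall H0 V G lam up, A H0 -> A0 V -> is_abs_sqrt V G ->
    Lam H0 V lam ->
    nontangential_limit (T0 G H0) lam up (boundary_value (T0 G H0) lam up) /\
    schatten +oo%E (boundary_value (T0 G H0) lam up);
  sa_im : forall H0 V G lam up, A H0 -> A0 V -> is_abs_sqrt V G ->
    Lam H0 V lam -> schatten pt (im_op (boundary_value (T0 G H0) lam up));
  sa_eigenvalue : forall H0 V G J lam, A H0 -> A0 V -> is_abs_sqrt V G ->
    is_sign V J -> Lam H0 V lam ->
    ~ invertible_op
        (fun x => inv_op J x + boundary_value (T0 G H0) lam true x) ->
    eigenvalue_op (uadd H0 V) lam%:C }.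

End AffineSpaces.

Section DirectIntegrals.
Context {R : realType} (h : R -> hilbertType R).

(* M is the space of measurable sections of the field h of Hilbert spaces. *)
Record measurable_field (M : set (forall t, h t)) : Prop := {
  mf_linear : forall (a : R[i]) s u, M s -> M u -> M (fun t => a *: s t + u t);
  mf_norm : forall s, M s -> measurable_fun [set: R] (fun t => rnorm (s t));
  mf_maximal : forall u,
    (forall s, M s ->
       measurable_fun [set: R] (fun t => complex.Re (dotp (u t) (s t))) /\
       measurable_fun [set: R] (fun t => complex.Im (dotp (u t) (s t)))) -> M u;
  mf_total : exists s : nat -> forall t, h t, (forall n, M (s n)) /\
    forall t (f : h t), (forall n, dotp f (s n t) = 0) -> f = 0 }.

(* Representatives of the elements of the direct integral. *)
Definition square_integrable (M : set (forall t, h t)) : set (forall t, h t) :=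
  [set s | M s /\
    (\int[@lebesgue_measure R]_t (rnorm (s t) ^+ 2)%:E < +oo)%E].

Definition ae_equal (s u : forall t, h t) : Prop :=
  {ae (@lebesgue_measure R), forall t, s t = u t}.

(* F is a unitary map of the absolutely continuous subspace of H onto the
   direct integral of h, taking H to multiplication by the variable; F is given
   by representatives, and its values off that subspace are irrelevant. *)
Record diagonalizes {X : hilbertType R} (H : unbounded_op X)
    (M : set (forall t, h t)) (F : X -> forall t, h t) : Prop := {
  diag_range : forall x, ac_subspace H x -> square_integrable M (F x);
  diag_linear : forall (a : R[i]) x y, ac_subspace H x -> ac_subspace H y ->
    ae_equal (F (a *: x + y)) (fun t => a *: F x t + F y t);
  diag_isometry : forall x, ac_subspace H x ->
    (\int[@lebesgue_measure R]_t (rnorm (F x t) ^+ 2)%:E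
       = (rnorm x ^+ 2)%:E)%E;
  diag_onto : forall s, square_integrable M s ->
    exists2 x, ac_subspace H x & ae_equal (F x) s;
  diag_dom : forall x, ac_subspace H x -> (udom H x <->
    square_integrable M (fun t => t%:C *: F x t));
  diag_mul : forall x, ac_subspace H x -> udom H x ->
    ae_equal (F (uact H x)) (fun t => t%:C *: F x t) }.

End DirectIntegrals.

Section ScatteringMatrix.
Context {R : realType} {X : hilbertType R}.

(* Z0(lam) f = (F0 P^(a)(H0) G f)(lam).  Elements of a direct integral being
   defined up to null sets, this is an equality for almost every lam in Lam;
   the values at all lam in Lam are fixed, up to an isometry, by
   pi Z0^* Z0 = B0(lam + i0). *)
Definition is_Z0 (h : R -> hilbertType R) (H0 : unbounded_op X) (G : X -> X)
    (F0 : X -> forall t, h t) (Lam : set R) (Z0 : forall t, X -> h t) : Prop :=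
  [/\ forall t, Lam t -> bounded_op (Z0 t),
      forall f, {ae (@lebesgue_measure R), forall t, Lam t ->
        Z0 t f = F0 (proj_onto (ac_subspace H0) (G f)) t} &
      forall t, Lam t -> forall f,
        pi%:C *: adj (Z0 t) (Z0 t f) =
        im_op (boundary_value (T0 G H0) t true) f].

(* T stands for T0(lam + i0) and Z for Z0(lam). *)
Definition scattering_matrix {K : hilbertType R} (T J : X -> X) (Z : X -> K)
    (r : R[i]) (f : K) : K :=
  f - (2 * pi%:C * 'i * r) *:
    Z (J (inv_op (fun x => x + r *: T (J x)) (adj Z f))).

Definition scattering_domain (T J : X -> X) : set R[i] :=
  [set r | invertible_op (fun x => x + r *: T (J x))].

(* r |-> (J^-1 + r T)^-1 *)
Definition sandwiched_inverse (T J : X -> X) (r : R[i]) : X -> X :=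
  inv_op (fun x => inv_op J x + r *: T x).

Definition sandwiched_domain (T J : X -> X) : set R[i] :=
  [set r | invertible_op (fun x => inv_op J x + r *: T x)].

End ScatteringMatrix.

(* Main.v *)
Require Import Defs.
From HB Require Import structures.
From mathcomp Require Import all_boot all_order all_algebra.
From mathcomp Require Import complex.
From mathcomp Require Import all_classical all_reals all_analysis.
From mathcomp Require Import ring lra.

Set Implicit Arguments.
Unset Strict Implicit.
Unset Printing Implicit Defensive.

Import Order.TTheory GRing.Theory Num.Theory.
Import numFieldNormedType.Exports.

(** The assumptions provide a compact T, a bounded J with real quadratic form,
    and a bounded Z with pi Z^* Z = Im T.  Write R(r) = (1 + r T J)^-1, so that
    S(r) = 1 - 2 pi i r Z J R(r) Z^*.

    Meromorphy.  It is enough to study R, that is, the inverse of 1 + r K with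
    K = T J compact.  Where 1 + c K is invertible, R is given near c by a
    Neumann series ([inverse_analytic]).  Elsewhere c is not 0, and the Riesz
    theory of A = 1 + c K ([riesz_decomposition]) splits the space into the
    generalized kernel of A and a complement on which A is invertible, both
    invariant under K.  With s = r - c, the operator 1 + r K = A + s K is a small
    perturbation of an invertible one on the complement, while
    c (1 + r K) = r A - s with A nilpotent on the former, so that its inverse
    there is a polynomial in 1/s ([inverse_meromorphic]).  This avoids
    determinants and the identity theorem for analytic functions.  The
    decomposition rests on the Fredholm alternative
    ([fredholm_alternative]), obtained from finite-rank approximation, and on
    the finite ascent of A ([finite_ascent]), obtained from total boundedness.

    Continuation.  For real r in its domain S(r) is isometric
    ([scattering_unitary]): if J u = w and u + r T w = Z^* f, the cross term
    Im <f, Z w> equals r Im <T w, w> = r pi |Z w|^2 because <u, J u> is real.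
    Let c be real and S(r) = (r - c)^-m G(r) near c with G analytic.  Then
    |G(c + t)| = t^m for small t > 0, hence the first m coefficients of G at c
    vanish ([ps_divide]) and S has a removable singularity at c. *)

Local Open Scope classical_set_scope.
Local Open Scope complex_scope.
Local Open Scope ring_scope.

(** * Norms and inner products *)

Section Norms.
Context {R : realType} {X : hilbertType R}.
Implicit Types (a b : R[i]) (x y z : X).

Definition cabs a : R := complex.Re `|a|.

Lemma cabsE a : (cabs a)%:C = `|a|.
Proof. by rewrite /cabs normc_def. Qed.

Lemma rnormE x : (rnorm x)%:C = `|x|.
Proof.
have := normr_ge0 x; rewrite /rnorm; case: `|x| => u v.
by rewrite lecE /= => /andP[/eqP -> _].
Qed.

Lemma cabs_ge0 a : 0 <= cabs a.
Proof. by rewrite -ler0c cabsE normr_ge0. Qed.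

Lemma rnorm_ge0 x : 0 <= rnorm x.
Proof. by rewrite -ler0c rnormE normr_ge0. Qed.

Lemma cabsX a n : cabs (a ^+ n) = cabs a ^+ n.
Proof. by apply: complexI; rewrite rmorphXn /= !cabsE normrX. Qed.

Lemma cabsV a : cabs a^-1 = (cabs a)^-1.
Proof. by apply: complexI; rewrite fmorphV /= !cabsE normfV. Qed.

Lemma cabs0 : cabs 0 = 0.
Proof. by apply: complexI; rewrite cabsE normr0. Qed.

Lemma cabsC (k : R) : 0 <= k -> cabs k%:C = k.
Proof. by move=> k0; apply: complexI; rewrite cabsE ger0_norm// ler0c. Qed.

Lemma cabs_gt0 a : (0 < cabs a) = (a != 0).
Proof. by rewrite -ltcR cabsE normr_gt0. Qed.

Lemma cabs_lt a (rho : R) : (`|a| < rho%:C) = (cabs a < rho).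
Proof. by rewrite -cabsE ltcR. Qed.

Lemma rnormZ a x : rnorm (a *: x) = cabs a * rnorm x.
Proof. by apply: complexI; rewrite rmorphM /= rnormE normrZ cabsE rnormE. Qed.

Lemma rnormD x y : rnorm (x + y) <= rnorm x + rnorm y.
Proof. by rewrite -lecR rmorphD /= !rnormE ler_normD. Qed.

Lemma rnormN x : rnorm (- x) = rnorm x.
Proof. by rewrite /rnorm normrN. Qed.

Lemma rnormB x y : rnorm (x - y) <= rnorm x + rnorm y.
Proof. by rewrite -[rnorm y]rnormN rnormD. Qed.

Lemma rnormBC x y : rnorm (x - y) = rnorm (y - x).
Proof. by rewrite -rnormN opprB. Qed.

Lemma rnorm_tri y x z : rnorm (x - z) <= rnorm (x - y) + rnorm (y - z).
Proof. by rewrite -{1}(subrK y x) -addrA rnormD. Qed.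

Lemma rnorm0 : rnorm (0 : X) = 0.
Proof. by apply: complexI; rewrite rnormE normr0. Qed.

Lemma rnorm_eq0 x : (rnorm x == 0) = (x == 0).
Proof. by rewrite -(inj_eq (@complexI R)) rnormE normr_eq0. Qed.

Lemma rnorm_gt0 x : (0 < rnorm x) = (x != 0).
Proof. by rewrite lt_def rnorm_ge0 rnorm_eq0 andbT. Qed.

Lemma rnorm_le0 x : rnorm x <= 0 -> x = 0.
Proof. by move=> h; apply/eqP; rewrite -rnorm_eq0 eq_le h rnorm_ge0. Qed.

Lemma rnorm_le_eps x y :
  (forall eps : R, 0 < eps -> rnorm (x - y) <= eps) -> x = y.
Proof.
move=> h; apply/eqP; rewrite -subr_eq0 -rnorm_eq0 eq_le rnorm_ge0 andbT.
by apply/ler_addgt0Pr => e e0; rewrite add0r h.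
Qed.

Lemma dotpDl x y z : dotp (x + y) z = dotp x z + dotp y z.
Proof. by have := dotp_linearl 1 x y z; rewrite scale1r mul1r. Qed.

Lemma dotp0l z : dotp (0 : X) z = 0.
Proof. by apply: (addIr (dotp (0 : X) z)); rewrite -dotpDl addr0 add0r. Qed.

Lemma dotpZl a x z : dotp (a *: x) z = a * dotp x z.
Proof. by have := dotp_linearl a x 0 z; rewrite addr0 dotp0l addr0. Qed.

Lemma dotpNl x z : dotp (- x) z = - dotp x z.
Proof. by rewrite -scaleN1r dotpZl mulN1r. Qed.

Lemma dotpBl x y z : dotp (x - y) z = dotp x z - dotp y z.
Proof. by rewrite dotpDl dotpNl. Qed.

Lemma dotpDr x y z : dotp z (x + y) = dotp z x + dotp z y.
Proof. by rewrite dotp_conj dotpDl rmorphD /= -!dotp_conj. Qed.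

Lemma dotpZr a x z : dotp z (a *: x) = a^* * dotp z x.
Proof. by rewrite dotp_conj dotpZl rmorphM /= -!dotp_conj. Qed.

Lemma dotp0r z : dotp z (0 : X) = 0.
Proof. by rewrite dotp_conj dotp0l rmorph0. Qed.

Lemma dotpNr x z : dotp z (- x) = - dotp z x.
Proof. by rewrite dotp_conj dotpNl rmorphN /= -dotp_conj. Qed.

Lemma dotpBr x y z : dotp z (x - y) = dotp z x - dotp z y.
Proof. by rewrite dotpDr dotpNr. Qed.

Lemma dotpxx x : dotp x x = (rnorm x ^+ 2)%:C.
Proof. by rewrite dotp_norm rmorphXn /= rnormE. Qed.

Lemma dotp_eq0C x y : dotp x y = 0 -> dotp y x = 0.
Proof. by move=> h; rewrite dotp_conj h rmorph0. Qed.

Lemma dotp_ext x y : (forall z, dotp z x = dotp z y) -> x = y.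
Proof.
move=> h; apply/eqP; rewrite -subr_eq0 -rnorm_eq0 -sqrf_eq0.
by rewrite -(inj_eq (@complexI R)) -dotpxx dotpBr h subrr.
Qed.

Lemma rnormD2 x y :
  rnorm (x + y) ^+ 2 = rnorm x ^+ 2 + rnorm y ^+ 2 + 2 * complex.Re (dotp x y).
Proof.
have := dotpxx (x + y); rewrite dotpDl !dotpDr !dotpxx [dotp y x]dotp_conj.
by case: (dotp x y) => u v /eqP; rewrite eq_complex /= => /andP[/eqP <- _]; ring.
Qed.

Lemma rnormB2 x y :
  rnorm (x - y) ^+ 2 = rnorm x ^+ 2 + rnorm y ^+ 2 - 2 * complex.Re (dotp x y).
Proof. by rewrite rnormD2 rnormN dotpNr raddfN /= mulrN. Qed.

Lemma pythagoras x y : dotp x y = 0 ->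
  rnorm (x + y) ^+ 2 = rnorm x ^+ 2 + rnorm y ^+ 2.
Proof. by move=> h; rewrite rnormD2 h /= mulr0 addr0. Qed.

Lemma ler_rnorm2 x (c : R) : 0 <= c -> rnorm x ^+ 2 <= c ^+ 2 -> rnorm x <= c.
Proof. by move=> c0; rewrite ler_pXn2r// nnegrE rnorm_ge0. Qed.

Lemma conjK (a : R[i]) : a^*^* = a.
Proof. exact: conjcK. Qed.

Lemma conj_real (k : R) : (k%:C)^* = k%:C.
Proof. exact: conjc_real. Qed.

Lemma conj_realV (k : R) : (k%:C^-1)^* = k%:C^-1.
Proof. by rewrite -fmorphV; exact: conjc_real. Qed.

Lemma cabs2 a : (cabs a ^+ 2)%:C = a * a^*.
Proof. by rewrite rmorphXn /= cabsE sqr_normc. Qed.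

(** Pythagoras for the component of x along y; it yields both the
    Cauchy-Schwarz inequality and the optimality of orthogonal projections. *)
Lemma rnorm_residual x y : y != 0 ->
  rnorm (x - (dotp x y / (rnorm y ^+ 2)%:C) *: y) ^+ 2 =
  rnorm x ^+ 2 - cabs (dotp x y) ^+ 2 / rnorm y ^+ 2.
Proof.
move=> y0; have ny : (rnorm y ^+ 2) != 0 by rewrite sqrf_eq0 rnorm_eq0.
apply: complexI; rewrite -[LHS]dotpxx dotpBl !dotpBr !dotpZl !dotpZr !dotpxx.
have e1 : (cabs (dotp x y) ^+ 2 / rnorm y ^+ 2)%:C =
    dotp x y * (dotp x y)^* / (rnorm y ^+ 2)%:C.
  by rewrite rmorphM /= cabs2 fmorphV.
have e2 : (dotp x y / (rnorm y ^+ 2)%:C)^* = (dotp x y)^* / (rnorm y ^+ 2)%:C.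
  by rewrite rmorphM fmorphV; congr (_ * _^-1); exact: conjc_real.
rewrite [dotp y x]dotp_conj rmorphB /= e1 e2.
have ny' : (rnorm y ^+ 2)%:C != 0 :> R[i].
  by rewrite -(rmorph0 (real_complex R)) (inj_eq (@complexI R)).
move: (dotp x y) ((rnorm y ^+ 2)%:C) ny' => p q q0.
move: (p^*) ((rnorm x ^+ 2)%:C) => p' s.
by field.
Qed.

Lemma cauchy_schwarz x y : cabs (dotp x y) <= rnorm x * rnorm y.
Proof.
have [->|y0] := eqVneq y 0; first by rewrite dotp0r cabs0 rnorm0 mulr0.
have ny : 0 < rnorm y ^+ 2 by rewrite exprn_gt0// rnorm_gt0.
have := sqr_ge0 (rnorm (x - (dotp x y / (rnorm y ^+ 2)%:C) *: y)).
rewrite rnorm_residual// subr_ge0 ler_pdivrMr// -exprMn ler_pXn2r// nnegrE.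
  exact: cabs_ge0.
by rewrite mulr_ge0// rnorm_ge0.
Qed.

Lemma parallelogram x y :
  rnorm (x + y) ^+ 2 + rnorm (x - y) ^+ 2 = 2 * rnorm x ^+ 2 + 2 * rnorm y ^+ 2.
Proof. by rewrite rnormD2 rnormB2; ring. Qed.

(** The topology of a normed module over the complex numbers is given by
    complex radii; this form of completeness has real tolerances instead. *)
Lemma cauchy_has_limit (u : nat -> X) :
  (forall eps : R, 0 < eps -> exists N : nat, forall m n, (N <= m)%N -> (N <= n)%N ->
     rnorm (u m - u n) <= eps) ->
  exists l, forall eps : R, 0 < eps -> exists N : nat, forall n, (N <= n)%N ->
     rnorm (u n - l) <= eps.
Proof.
move=> hu.
have realC (e : R[i]) : 0 < e -> e = (complex.Re e)%:C /\ 0 < complex.Re e.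
  by case: e => p q; rewrite ltcE /= => /andP[/eqP -> p0]; split.
have cu : cvg (u @ \oo).
  apply/cauchy_cvgP/cauchy_exP => e e0.
  have [ee re0] := realC _ e0; have [N hN] := hu _ (divr_gt0 re0 (ltr0n R 2)).
  exists (u N); exists N => //= n nN.
  rewrite -ball_normE /= ee -rnormE ltcR.
  by apply: le_lt_trans (hN _ _ (leqnn N) nN) _; lra.
exists (lim (u @ \oo)) => e e0.
have /cvgrPdist_lt /(_ e%:C) := cu.
rewrite ltcR => /(_ e0)[N _ hN]; exists N => n nN.
have := hN n nN; rewrite /= -rnormE ltcR rnormBC; exact: ltW.
Qed.

End Norms.

(** * Bounded operators *)

Section Linear.
Context {K : pzRingType} {X Y : lmodType K} {T : X -> Y}.
Hypothesis lT : linear T.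

Lemma lin0 : T 0 = 0.
Proof. by apply: (addIr (T 0)); rewrite -{1}[T 0]scale1r -lT scaler0 !add0r. Qed.

Lemma linZ a x : T (a *: x) = a *: T x.
Proof. by rewrite -[a *: x]addr0 lT lin0 addr0. Qed.

Lemma linD x y : T (x + y) = T x + T y.
Proof. by rewrite -{1}[x]scale1r lT scale1r. Qed.

Lemma linN x : T (- x) = - T x.
Proof. by rewrite -scaleN1r linZ scaleN1r. Qed.

Lemma linB x y : T (x - y) = T x - T y.
Proof. by rewrite linD linN. Qed.

Lemma lin_sum n (f : 'I_n -> X) : T (\sum_(i < n) f i) = \sum_(i < n) T (f i).
Proof. exact: (big_morph T linD lin0). Qed.

End Linear.

Lemma small_invS (R : realType) (e : R) : 0 < e ->
  exists N : nat, forall n, (N <= n)%N -> n.+1%:R^-1 <= e.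
Proof.
move=> e0; have [N _ hN] := near_infty_natSinv_lt (PosNum e0).
by exists N => n /hN /ltW.
Qed.

Section Bounded.
Context {R : realType}.
Implicit Types X Y Z : hilbertType R.

Lemma bounded_lin X Y (T : X -> Y) : bounded_op T -> linear T.
Proof. by case. Qed.

Lemma bounded_bound X Y (T : X -> Y) : bounded_op T ->
  exists2 c : R, 0 < c & forall x, rnorm (T x) <= c * rnorm x.
Proof.
case=> _ [c hc]; exists (`|c| + 1) => [|x]; first by rewrite ltr_wpDl.
apply: le_trans (hc x) _; rewrite ler_wpM2r ?rnorm_ge0//.
by rewrite (le_trans (ler_norm c))// lerDl.
Qed.

Lemma bounded_id X : bounded_op (fun x : X => x).
Proof. by split=> //; exists 1 => x; rewrite mul1r. Qed.

Lemma bounded_zero X Y : bounded_op (fun _ : X => 0 : Y).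
Proof.
by split=> [a x y|]; [rewrite scaler0 addr0 | exists 0 => x; rewrite rnorm0 mul0r].
Qed.

Lemma bounded_comp X Y Z (S : Y -> Z) (T : X -> Y) :
  bounded_op S -> bounded_op T -> bounded_op (fun x => S (T x)).
Proof.
move=> bS bT; split=> [a x y|].
  by rewrite (bounded_lin bT) (bounded_lin bS).
have [c c0 hc] := bounded_bound bS; have [d d0 hd] := bounded_bound bT.
exists (c * d) => x; apply: le_trans (hc _) _.
by rewrite -mulrA ler_pM2l.
Qed.

Lemma bounded_add X Y (S T : X -> Y) :
  bounded_op S -> bounded_op T -> bounded_op (fun x => S x + T x).
Proof.
move=> [lS [c hc]] [lT [d hd]]; split=> [a x y|].
  by rewrite lS lT scalerDr addrACA.
exists (c + d) => x; apply: le_trans (rnormD _ _) _.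
by rewrite mulrDl lerD.
Qed.

Lemma bounded_scale X Y (a : R[i]) (T : X -> Y) :
  bounded_op T -> bounded_op (fun x => a *: T x).
Proof.
move=> [lT [c hc]]; split=> [b x y|].
  by rewrite lT scalerDr !scalerA [a * b]mulrC.
by exists (cabs a * c) => x; rewrite rnormZ -mulrA ler_wpM2l// cabs_ge0.
Qed.

Lemma bounded_sub X Y (S T : X -> Y) :
  bounded_op S -> bounded_op T -> bounded_op (fun x => S x - T x).
Proof.
move=> bS bT; have := bounded_add bS (bounded_scale (-1) bT).
rewrite (_ : (fun x => _ + _) = (fun x => S x - T x))//.
by apply/funext => x; rewrite scaleN1r.
Qed.

Lemma bounded_sum X Y n (f : 'I_n -> X -> Y) :
  (forall i, bounded_op (f i)) -> bounded_op (fun x => \sum_(i < n) f i x).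
Proof.
elim: n f => [f _|n IH f hf].
  rewrite (_ : (fun x => _) = (fun=> 0)); first exact: bounded_zero.
  by apply/funext => x; rewrite big_ord0.
rewrite (_ : (fun x => _) =
    (fun x => \sum_(i < n) f (widen_ord (leqnSn n) i) x + f ord_max x)).
  by apply: bounded_add => //; apply: IH.
by apply/funext => x; rewrite big_ord_recr.
Qed.

Lemma bounded_iter X (A : X -> X) n : bounded_op A -> bounded_op (iter n A).
Proof.
move=> bA; elim: n => [|n IH]; first exact: bounded_id.
exact: (bounded_comp bA IH).
Qed.

End Bounded.

(** * Orthogonal projections, Riesz representation and adjoints *)

Section Projection.
Context {R : realType} {X : hilbertType R}.
Implicit Types (x y z : X) (N : X -> Prop).

Definition closed_subspace N : Prop :=
  [/\ N 0, forall (a : R[i]) x y, N x -> N y -> N (a *: x + y) &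
    forall x, (forall eps : R, 0 < eps -> exists2 y, N y & rnorm (x - y) <= eps) -> N x].

(** The midpoint of two nearly closest points also lies in N, so the
    parallelogram law leaves little room for their difference. *)
Lemma minimizing_sequence_cauchy (x : X) N (d : R) (u : nat -> X) :
  0 <= d ->
  (forall (a : R[i]) x y, N x -> N y -> N (a *: x + y)) -> N 0 ->
  (forall y, N y -> d <= rnorm (x - y)) ->
  (forall n, N (u n) /\ rnorm (x - u n) <= d + n.+1%:R^-1) ->
  forall eps : R, 0 < eps -> exists k : nat, forall m n, (k <= m)%N -> (k <= n)%N ->
     rnorm (u m - u n) <= eps.
Proof.
move=> d0 Nl N0 hd hu eps eps0.
have e1 : 0 < eps ^+ 2 / (8 * d + 4).
  by rewrite divr_gt0 ?exprn_gt0//; lra.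
have [k1 hk1] := small_invS e1; have [k2 hk2] := small_invS (ltr01 : (0 : R) < 1).
pose e : R := (maxn k1 k2).+1%:R^-1.
have e0 : 0 < e by rewrite invr_gt0 ltr0n.
have eS : e <= 1 by apply: hk2; rewrite leq_maxr.
have eM : e * (8 * d + 4) <= eps ^+ 2.
  by rewrite -ler_pdivlMr; [apply: hk1; rewrite leq_maxl | lra].
exists (maxn k1 k2) => m n km kn.
apply: ler_rnorm2; first exact: ltW.
have le_e j : (maxn k1 k2 <= j)%N -> rnorm (x - u j) <= d + e.
  move=> kj; apply: le_trans (hu j).2 _; rewrite lerD2l.
  by rewrite lef_pV2 ?posrE ?ltr0n// ler_nat ltnS.
have hp := parallelogram (x - u n) (x - u m).
have -> : u m - u n = (x - u n) - (x - u m).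
  by rewrite opprB [u m - x]addrC addrACA subrr add0r addrC.
have hmid : 4 * d ^+ 2 <= rnorm (x - u n + (x - u m)) ^+ 2.
  have Nm : N (2^-1 *: (u n + u m)).
    rewrite -[_ *: _]addr0; apply: (Nl) => //.
    by have := Nl 1 _ _ (hu n).1 (hu m).1; rewrite scale1r.
  have -> : x - u n + (x - u m) = 2 *: (x - 2^-1 *: (u n + u m)).
    rewrite scalerBr scalerA divff ?pnatr_eq0// scale1r.
    by rewrite scaler_nat mulr2n addrACA opprD.
  rewrite rnormZ exprMn (_ : cabs 2 = 2); last first.
    by rewrite (_ : 2 = (2 : R)%:C) ?cabsC// rmorph_nat.
  have h1 := hd _ Nm.
  have : d ^+ 2 <= rnorm (x - 2^-1 *: (u n + u m)) ^+ 2.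
    by rewrite ler_pXn2r// nnegrE rnorm_ge0.
  by rewrite -natrX; lra.
have b1 : rnorm (x - u n) ^+ 2 <= (d + e) ^+ 2.
  by rewrite ler_pXn2r ?nnegrE ?rnorm_ge0 ?le_e//; lra.
have b2 : rnorm (x - u m) ^+ 2 <= (d + e) ^+ 2.
  by rewrite ler_pXn2r ?nnegrE ?rnorm_ge0 ?le_e//; lra.
have : (d + e) ^+ 2 = d ^+ 2 + 2 * d * e + e ^+ 2 by ring.
have : e ^+ 2 <= e by rewrite -[leRHS]mulr1 expr2 ler_pM2l.
nra.
Qed.

(** The closest point p of N works: if x - p had a component along some z in
    N, moving p by that component would bring it closer to x. *)
Lemma projection_exists N x : closed_subspace N ->
  exists2 p, N p & forall z, N z -> dotp (x - p) z = 0.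
Proof.
move=> [N0 Nl Nc].
pose D := [set rnorm (x - y) | y in N].
have D0 : has_inf D.
  split; first by exists (rnorm (x - 0)), 0.
  by exists 0 => _ [y _ <-]; exact: rnorm_ge0.
pose d := inf D.
have hd y : N y -> d <= rnorm (x - y).
  by move=> Ny; apply: ge_inf; [exact: D0.2 | exists y].
have d0 : 0 <= d by apply: lb_le_inf; [exact: D0.1 | move=> _ [y _ <-]; exact: rnorm_ge0].
have /choice[u hu] (n : nat) : exists y, N y /\ rnorm (x - y) <= d + n.+1%:R^-1.
  have n0 : 0 < n.+1%:R^-1 :> R by rewrite invr_gt0 ltr0n.
  have [_ [y Ny <-] hy] := inf_adherent n0 D0.
  by exists y; split=> //; exact: ltW.
have [p hp] := cauchy_has_limit (minimizing_sequence_cauchy d0 Nl N0 hd hu).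
have Np : N p.
  apply: Nc => eps e0; have [k hk] := hp _ e0.
  by exists (u k); [exact: (hu k).1 | rewrite rnormBC hk].
have hpd : rnorm (x - p) <= d.
  apply/ler_addgt0Pr => e e0; have e2 : 0 < e / 2 by lra.
  have [k1 hk1] := hp _ e2; have [k2 hk2] := small_invS e2.
  pose k := maxn k1 k2.
  apply: le_trans (rnorm_tri (u k) _ _) _.
  rewrite (splitr e) addrA lerD ?hk1 ?leq_maxl//.
  by apply: le_trans (hu k).2 _; rewrite lerD2l hk2// leq_maxr.
exists p => // z Nz.
have [->|z0] := eqVneq z 0; first by rewrite dotp0r.
have nz : 0 < rnorm z ^+ 2 by rewrite exprn_gt0// rnorm_gt0.
have hres := rnorm_residual (x - p) z0.
set t := dotp (x - p) z / _ in hres.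
have Nt : N (t *: z + p) by exact: Nl.
have h1 : rnorm (x - p) <= rnorm (x - p - t *: z).
  by rewrite -addrA -opprD [p + _]addrC; apply: le_trans hpd (hd _ Nt).
have : rnorm (x - p) ^+ 2 <= rnorm (x - p - t *: z) ^+ 2.
  by rewrite ler_pXn2r// nnegrE rnorm_ge0.
rewrite hres lerDl oppr_ge0 pmulr_lle0 ?invr_gt0// => h2.
apply/eqP; move: h2; apply: contraLR.
by rewrite -cabs_gt0 -ltNge => h; rewrite exprn_gt0.
Qed.

(** A nonzero functional vanishes on a closed hyperplane, so it is a multiple
    of the inner product with any vector w orthogonal to that hyperplane. *)
Lemma riesz_representation (phi : X -> R[i]) (c : R) :
  (forall a x y, phi (a *: x + y) = a * phi x + phi y) ->
  (forall x, cabs (phi x) <= c * rnorm x) ->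
  exists z, forall x, phi x = dotp x z.
Proof.
move=> lphi bphi.
have phi0 : phi 0 = 0.
  by apply: (addIr (phi 0)); rewrite -{1}[phi 0]mul1r -lphi scaler0 !add0r.
have phiZ a x : phi (a *: x) = a * phi x.
  by rewrite -[a *: x]addr0 lphi phi0 addr0.
have phiB x y : phi (x - y) = phi x - phi y.
  by rewrite addrC -scaleN1r lphi mulN1r addrC.
have [h0|] := pselect (forall x, phi x = 0).
  by exists 0 => x; rewrite h0 dotp0r.
move=> /existsNP[x0 /eqP hx0].
have cN : closed_subspace (fun x => phi x = 0).
  split=> // [a x y hx hy|x hx]; first by rewrite lphi hx hy mulr0 addr0.
  apply/eqP; rewrite -[_ == _]negbK -cabs_gt0 -leNgt.
  apply/ler_addgt0Pr => e e0; rewrite add0r.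
  have c0 : 0 < `|c| + 1 by rewrite ltr_wpDl.
  have [y hy hxy] := hx _ (divr_gt0 e0 c0).
  rewrite -[phi x]subr0 -hy -phiB; apply: le_trans (bphi _) _.
  apply: (@le_trans _ _ ((`|c| + 1) * rnorm (x - y))).
    rewrite ler_wpM2r ?rnorm_ge0//.
    by rewrite (le_trans (ler_norm c))// lerDl.
  by rewrite -ler_pdivlMl// mulrC.
have [p hp orth] := projection_exists x0 cN.
pose w := x0 - p.
have hw : phi w != 0 by rewrite phiB hp subr0.
have w0 : w != 0 by apply: contraNneq hw => ->; rewrite phi0.
have nw : (rnorm w ^+ 2)%:C != 0 :> R[i].
  by rewrite -(rmorph0 (real_complex R)) (inj_eq (@complexI R)) sqrf_eq0 rnorm_eq0.
exists (((phi w)^* / (rnorm w ^+ 2)%:C) *: w) => x.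
have : dotp (x - (phi x / phi w) *: w) w = 0.
  by apply: dotp_eq0C; apply: orth; rewrite phiB phiZ divfK// subrr.
rewrite dotpBl dotpZl dotpxx => /eqP; rewrite subr_eq0 => /eqP hxw.
have -> : dotp x (((phi w)^* / (rnorm w ^+ 2)%:C) *: w)
    = phi w / (rnorm w ^+ 2)%:C * dotp x w.
  rewrite dotpZr rmorphM fmorphV; congr (_ / _ * _); first exact: conjcK.
  exact: conjc_real.
rewrite hxw; move: ((rnorm w ^+ 2)%:C) nw (phi w) hw (phi x) => q q0 a a0 b.
by field; rewrite a0.
Qed.

End Projection.

Section Adjoint.
Context {R : realType} {X Y : hilbertType R} {T : X -> Y}.
Hypothesis bT : bounded_op T.

Lemma adjP x y : dotp (T x) y = dotp x (adj T y).
Proof.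
have [c c0 hc] := bounded_bound bT.
have [z hz] : exists z, forall x, dotp (T x) y = dotp x z.
  apply: (@riesz_representation _ _ (fun x => dotp (T x) y) (c * rnorm y)).
    by move=> a u v; rewrite (bounded_lin bT) dotp_linearl.
  move=> u; apply: le_trans (cauchy_schwarz _ _) _.
  by rewrite mulrAC ler_wpM2r// rnorm_ge0.
by apply: (@xgetPex _ 0 [set z | forall x, dotp (T x) y = dotp x z]); exists z.
Qed.

(** The bound comes from |T^* y|^2 = <T T^* y, y>. *)
Lemma bounded_adj : bounded_op (adj T).
Proof.
split=> [a x y|].
  by apply: dotp_ext => z; rewrite -adjP !dotpDr !dotpZr !adjP.
have [c c0 hc] := bounded_bound bT; exists c => y.
have [->|n0] := eqVneq (adj T y) 0; first by rewrite rnorm0 mulr_ge0 ?rnorm_ge0 ?ltW.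
rewrite -rnorm_gt0 in n0; rewrite -(ler_pM2l n0) -expr2.
rewrite -(cabsC (sqr_ge0 (rnorm (adj T y)))) -dotpxx -adjP.
apply: le_trans (cauchy_schwarz _ _) _.
by rewrite mulrA ler_wpM2r ?rnorm_ge0// mulrC hc.
Qed.

End Adjoint.

(** * Inverse operators and their perturbations *)

Section Invertibility.
Context {R : realType} {X Y : hilbertType R}.

Lemma inv_opE (T : X -> Y) (S : Y -> X) : cancel T S -> cancel S T -> inv_op T = S.
Proof.
move=> TK SK; apply/funext => y.
by apply: xget_unique => [|x <-]; [exact: SK | rewrite TK].
Qed.

Lemma invertibleP (T : X -> Y) : invertible_op T ->
  [/\ bounded_op (inv_op T), cancel T (inv_op T) & cancel (inv_op T) T].
Proof. by case=> S [bS TK SK]; rewrite (inv_opE TK SK). Qed.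

Lemma invertible_of_right_inverse (T : X -> Y) (S : Y -> X) :
  linear T -> (forall x, T x = 0 -> x = 0) -> bounded_op S -> cancel S T ->
  invertible_op T.
Proof.
move=> lT iT bS SK; exists S; split=> // x.
by apply/subr0_eq/iT; rewrite (linB lT) SK subrr.
Qed.

Lemma invertible_of_bounded_below (T : X -> Y) (c : R) :
  linear T -> (forall y, exists x, T x = y) ->
  (forall x, rnorm x <= c * rnorm (T x)) ->
  invertible_op T /\ forall y, rnorm (inv_op T y) <= c * rnorm y.
Proof.
move=> lT sT bT.
have iT x y : T x = T y -> x = y.
  move=> h; apply/subr0_eq/rnorm_le0.
  by apply: le_trans (bT _) _; rewrite (linB lT) h subrr rnorm0 mulr0.
have SK : cancel (inv_op T) T.
  by move=> y; apply: (@xgetPex _ 0 [set x | T x = y]); exact: sT.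
have bS y : rnorm (inv_op T y) <= c * rnorm y by rewrite -{2}[y]SK.
split=> //; exists (inv_op T); split=> // [|x]; last by apply: iT; rewrite SK.
split; last by exists c.
by move=> a x y; apply: iT; rewrite lT !SK.
Qed.

End Invertibility.

Section Neumann.
Context {R : realType} {X : hilbertType R}.

Lemma expr_half_le_invS k : (2^-1 : R) ^+ k <= k.+1%:R^-1.
Proof.
rewrite exprVn lef_pV2 ?posrE ?ltr0n ?exprn_gt0 ?ltr0n//.
by rewrite -natrX ler_nat; exact: ltn_expl.
Qed.

(** The equation x + B x = y is solved by iterating the contraction
    u |-> y - B u. *)
Lemma contraction_onto (B : X -> X) : linear B ->
  (forall x, rnorm (B x) <= 2^-1 * rnorm x) -> forall y, exists x, x + B x = y.
Proof.
move=> lB bB y; pose u n := iter n (fun v => y - B v) 0.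
have h0 n : rnorm (u n) <= 2 * rnorm y.
  elim: n => [|n IH]; first by rewrite rnorm0 mulr_ge0 ?rnorm_ge0.
  apply: le_trans (rnormB _ _) _; have := bB (u n); lra.
have hk k m n : (k <= m)%N -> (k <= n)%N ->
    rnorm (u m - u n) <= 2^-1 ^+ k * (4 * rnorm y).
  elim: k m n => [|k IH] m n.
    by move=> _ _; rewrite expr0 mul1r; apply: le_trans (rnormB _ _) _;
       have := h0 m; have := h0 n; lra.
  case: m => // m; case: n => // n; rewrite !ltnS => km kn.
  have -> : u m.+1 - u n.+1 = B (u n - u m).
    by rewrite (linB lB) /u /= opprB addrC addrA subrK.
  apply: le_trans (bB _) _; rewrite exprS -mulrA ler_pM2l ?invr_gt0//.
  exact: IH.
have [l hl] : exists l, forall eps : R, 0 < eps -> exists N : nat,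
    forall n, (N <= n)%N -> rnorm (u n - l) <= eps.
  apply: cauchy_has_limit => eps eps0.
  have c0 : 0 < 4 * rnorm y + 1 by rewrite ltr_wpDl// mulr_ge0 ?rnorm_ge0.
  have [N hN] := small_invS (divr_gt0 eps0 c0).
  exists N => m n Nm Nn; apply: le_trans (hk N _ _ Nm Nn) _.
  apply: (@le_trans _ _ (eps / (4 * rnorm y + 1) * (4 * rnorm y))).
    rewrite ler_wpM2r ?mulr_ge0 ?rnorm_ge0//.
    exact: le_trans (expr_half_le_invS N) (hN _ (leqnn _)).
  by rewrite mulrAC ler_pdivrMr// ler_pM2l// lerDl.
exists l; apply: rnorm_le_eps => eps e0.
have [N hN] := hl _ (divr_gt0 e0 (ltr0n R 2)).
have -> : l + B l - y = B (l - u N) - (u N.+1 - l).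
  rewrite (linB lB) [u N.+1]/= opprB [RHS]addrC -!addrA; congr (l + _).
  by rewrite opprB [RHS]addrC addrA subrK.
apply: le_trans (rnormB _ _) _.
have := hN _ (leqnn N); have := hN _ (leqnSn N); have := bB (l - u N).
rewrite [rnorm (l - _)]rnormBC; have := rnorm_ge0 (u N - l); lra.
Qed.

(** If |s| |B| is at most half the lower bound of W, then half of that bound
    survives the perturbation, and [contraction_onto] for s B W^-1 gives
    surjectivity. *)
Lemma invertible_perturbation (W B : X -> X) :
  bounded_op W -> invertible_op W -> bounded_op B ->
  exists rho C : R, [/\ 0 < rho, 0 < C & forall s : R[i], cabs s < rho ->
    invertible_op (fun x => W x + s *: B x) /\
    forall y, rnorm (inv_op (fun x => W x + s *: B x) y) <= C * rnorm y].
Proof.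
move=> bW /invertibleP[bV VK WK] bB; set V := inv_op W in bV VK WK.
have [c c0 hc] := bounded_bound bV; have [b b0 hb] := bounded_bound bB.
have cb : 0 < 2 * (c * b) by rewrite !mulr_gt0.
exists (2 * (c * b))^-1, (2 * c); split; rewrite ?invr_gt0 ?mulr_gt0// => s hs.
have hs2 : cabs s * (c * b) <= 2^-1.
  have : cabs s * (2 * (c * b)) <= 1 by rewrite -ler_pdivlMr// div1r ltW.
  lra.
have lT : linear (fun x => W x + s *: B x).
  by case: (bounded_add bW (bounded_scale s bB)).
have bB' x : rnorm (s *: B (V x)) <= 2^-1 * rnorm x.
  rewrite rnormZ; apply: (@le_trans _ _ (cabs s * (b * (c * rnorm x)))).
    by rewrite ler_wpM2l ?cabs_ge0//; apply: le_trans (hb _) _; rewrite ler_pM2l.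
  by rewrite mulrA mulrA -[_ * b * c]mulrA [b * c]mulrC ler_wpM2r ?rnorm_ge0.
apply: invertible_of_bounded_below => // [y|x].
  have [|z hz] := contraction_onto _ bB' y.
    exact: (bounded_lin (bounded_scale s (bounded_comp bB bV))).
  by exists (V z); rewrite WK.
have h1 : rnorm x <= c * rnorm (W x) by rewrite -{1}[x]VK.
have h2 : rnorm (W x) <= rnorm (W x + s *: B x) + cabs s * rnorm (B x).
  by rewrite -rnormZ; apply: le_trans (rnormB _ _); rewrite addrK.
have h3 : cabs s * rnorm (B x) <= cabs s * (b * rnorm x).
  by rewrite ler_wpM2l ?cabs_ge0.
have h4 : cabs s * (c * b) * rnorm x <= 2^-1 * rnorm x.
  by rewrite ler_wpM2r ?rnorm_ge0.
have h5 : c * rnorm (W x) <= c * (rnorm (W x + s *: B x) + cabs s * (b * rnorm x)).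
  by rewrite ler_pM2l//; apply: le_trans h2 _; rewrite lerD2l.
move: (rnorm (W x + s *: B x)) h5 => w; nra.
Qed.

End Neumann.

(** * Compactness and the Fredholm alternative *)

Section TotallyBounded.
Context {R : realType}.
Implicit Types X Y Z : hilbertType R.

(** For a bounded operator between complete spaces this is compactness.  It is
    stated with nets because these add up under sums of operators, and because
    finite-rank approximations are built from them. *)
Definition totally_bounded_op X Y (K : X -> Y) : Prop :=
  forall eps : R, 0 < eps -> exists s : seq Y, forall x, rnorm x <= 1 ->
    exists2 y, y \in s & rnorm (K x - y) <= eps.

Lemma tb_compact X Y (K : X -> Y) : compact_op K -> totally_bounded_op K.
Proof.
move=> [_]; rewrite precompactE compact_cover => cK eps eps0.
have [|y _|D _ hD] := @cK Y setT (fun y => ball y (eps%:C : R[i])).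
- by move=> y _; apply: ball_open; rewrite ltcR.
- by exists y => //; apply: ballxx; rewrite ltcR.
exists (finmap.enum_fset D) => x hx; have [|y /= yD hy] := hD (K x).
  by apply: subset_closure; exists x.
exists y => //; move: hy.
by rewrite -ball_normE /= -rnormE ltcR rnormBC => /ltW.
Qed.

Lemma tb_add X Y (K L : X -> Y) :
  totally_bounded_op K -> totally_bounded_op L -> totally_bounded_op (fun x => K x + L x).
Proof.
move=> hK hL eps eps0; have e2 : 0 < eps / 2 by rewrite divr_gt0.
have [s hs] := hK _ e2; have [t ht] := hL _ e2.
exists [seq a + b | a <- s, b <- t] => x hx.
have [a as_ ha] := hs x hx; have [b bt hb] := ht x hx.
exists (a + b); first by apply/allpairsP; exists (a, b).
by rewrite opprD addrACA [leRHS]splitr; apply: le_trans (rnormD _ _) (lerD ha hb).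
Qed.

Lemma tb_compl X Y Z (B : Y -> Z) (K : X -> Y) :
  bounded_op B -> totally_bounded_op K -> totally_bounded_op (fun x => B (K x)).
Proof.
move=> bB hK eps eps0; have [b b0 hb] := bounded_bound bB.
have [s hs] := hK _ (divr_gt0 eps0 b0); exists (map B s) => x hx.
have [y ys hy] := hs x hx; exists (B y); first exact: map_f.
rewrite -(linB (bounded_lin bB)); apply: le_trans (hb _) _.
by rewrite -ler_pdivlMl// mulrC.
Qed.

Lemma tb_compr X Y Z (K : Y -> Z) (B : X -> Y) :
  linear K -> bounded_op B -> totally_bounded_op K -> totally_bounded_op (fun x => K (B x)).
Proof.
move=> lK bB hK eps eps0; have [b b0 hb] := bounded_bound bB.
have [s hs] := hK _ (divr_gt0 eps0 b0); exists (map ( *:%R b%:C) s) => x hx.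
have bn : b%:C != 0 :> R[i] by rewrite -cabs_gt0 cabsC// ltW.
have [|y ys hy] := hs (b%:C^-1 *: B x).
  rewrite rnormZ cabsV cabsC ?(ltW b0)// ler_pdivrMl// mulr1.
  by apply: le_trans (hb x) _; rewrite -[leRHS]mulr1 ler_pM2l.
exists (b%:C *: y); first exact: map_f.
rewrite -[K (B x)](scalerKV bn) -(linZ lK) -scalerBr rnormZ cabsC ?(ltW b0)//.
by rewrite -ler_pdivlMl// mulrC.
Qed.

End TotallyBounded.

Section Fredholm.
Context {R : realType} {X : hilbertType R}.

Lemma bounded_rank_one (T : X -> X) (e v : X) :
  bounded_op T -> bounded_op (fun x => dotp (T x) e *: v).
Proof.
move=> bT; split=> [a x y|].
  by rewrite (bounded_lin bT) dotp_linearl scalerDl scalerA.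
have [c c0 hc] := bounded_bound bT.
exists (c * rnorm e * rnorm v) => x.
rewrite rnormZ mulrAC ler_wpM2r ?rnorm_ge0//.
apply: le_trans (cauchy_schwarz _ _) _.
by rewrite mulrAC ler_wpM2r ?rnorm_ge0.
Qed.

Definition expansion (l : seq X) (x : X) : X := \sum_(e <- l) dotp x e *: e.

Lemma expansion_sym l x y : dotp (expansion l x) y = dotp x (expansion l y).
Proof.
rewrite /expansion; elim: l => [|e l IH]; first by rewrite !big_nil dotp0l dotp0r.
rewrite !big_cons dotpDl dotpDr IH dotpZl dotpZr; congr (_ + _).
by rewrite [dotp y e]dotp_conj conjK mulrC.
Qed.

Lemma linear_expansion l : linear (expansion l).
Proof.
move=> a u v; rewrite /expansion scaler_sumr -big_split; apply: eq_bigr => e _.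
by rewrite /= dotp_linearl scalerDl scalerA.
Qed.

(** Gram-Schmidt.  The orthonormality of the family only enters through the
    idempotence of its expansion operator, which is always symmetric. *)
Lemma gram_schmidt (s : seq X) : exists l,
  (forall x, expansion l (expansion l x) = expansion l x) /\
  forall y, y \in s -> expansion l y = y.
Proof.
elim: s => [|y s [l [idl hl]]].
  by exists [::]; split=> // x; rewrite /expansion !big_nil.
have [hy|hy] := eqVneq (y - expansion l y) 0.
  exists l; split=> // z; rewrite inE => /predU1P[->|]; last exact: hl.
  by apply/esym/subr0_eq.
pose w := y - expansion l y.
have linE := linear_expansion l.
pose v := (rnorm w)%:C^-1 *: w.
have nw : (rnorm w)%:C != 0 :> R[i] by rewrite -cabs_gt0 cabsC ?rnorm_ge0// rnorm_gt0.
have Pw : expansion l w = 0 by rewrite (linB linE) idl subrr.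
have Pv : expansion l v = 0 by rewrite (linZ linE) Pw scaler0.
have vv : dotp v v = 1.
  rewrite dotpxx rnormZ cabsV cabsC ?rnorm_ge0// mulVf ?expr1n//.
  by rewrite -cabs_gt0 in nw; rewrite gt_eqF// -(cabsC (rnorm_ge0 w)).
have E' x : expansion (v :: l) x = dotp x v *: v + expansion l x.
  by rewrite /expansion big_cons.
have orth x : dotp (expansion l x) v = 0 by rewrite expansion_sym Pv dotp0r.
exists (v :: l); split=> [x|z].
  rewrite !E' dotpDl dotpZl vv mulr1 orth addr0 (linD linE) (linZ linE) Pv.
  by rewrite scaler0 add0r idl.
rewrite E' inE => /predU1P[->|zs]; last by rewrite -{1}(hl _ zs) orth scale0r add0r hl.
have -> : dotp y v *: v = w.
  rewrite -[y](subrK (expansion l y)) -/w dotpDl orth addr0 /v dotpZr scalerA.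
  rewrite conj_realV dotpxx rmorphXn /=.
  rewrite [X in X *: _](_ : _ = 1) ?scale1r//.
  by move: (_%:C) nw => q q0; field.
by rewrite subrK.
Qed.

(** Project onto the span of a net: the projection fixes the net and shrinks
    the distance from K x to it. *)
Lemma finite_rank_approximation (K : X -> X) (eps : R) :
  linear K -> totally_bounded_op K -> 0 < eps ->
  exists l, forall x, rnorm (K x - expansion l (K x)) <= eps * rnorm x.
Proof.
move=> lK hK eps0; have [s hs] := hK _ eps0; have [l [idl hl]] := gram_schmidt s.
have linE := linear_expansion l.
have contr z : rnorm (z - expansion l z) <= rnorm z.
  apply: ler_rnorm2; first exact: rnorm_ge0.
  have := @pythagoras _ _ (z - expansion l z) (expansion l z).
  rewrite subrK -expansion_sym (linB linE) idl subrr dotp0l => ->//.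
  by rewrite lerDl sqr_ge0.
exists l => x; have [->|x0] := eqVneq x 0.
  by rewrite (lin0 lK) (lin0 linE) subrr rnorm0 mulr0.
pose n := rnorm x; have n0 : 0 < n by rewrite rnorm_gt0.
have nC : n%:C != 0 :> R[i] by rewrite -cabs_gt0 cabsC// ltW.
have [|y ys hy] := hs (n%:C^-1 *: x).
  by rewrite rnormZ cabsV cabsC ?(ltW n0)// mulVf// gt_eqF.
have := contr (K (n%:C^-1 *: x) - y).
rewrite (linB linE) (hl _ ys) opprB addrA subrK => h.
have := le_trans h hy.
rewrite (linZ lK) (linZ linE) -scalerBr rnormZ cabsV cabsC ?(ltW n0)//.
by rewrite ler_pdivrMl// mulrC.
Qed.

(** The Fredholm alternative.  Up to an invertible factor, identity plus
    compact is identity plus finite rank, and solving an equation with the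
    latter operator amounts to inverting a square matrix, whose kernel is
    trivial by injectivity. *)
Lemma fredholm_alternative (K : X -> X) : bounded_op K -> totally_bounded_op K ->
  (forall x, x + K x = 0 -> x = 0) -> invertible_op (fun x => x + K x).
Proof.
move=> bK tK inj; have lK := bounded_lin bK.
have lA : linear (fun x => x + K x) by case: (bounded_add (bounded_id X) bK).
have [|l hl] := finite_rank_approximation lK tK (_ : 0 < 2^-1).
  by rewrite invr_gt0.
pose n := size l; pose e (i : 'I_n) := tnth (in_tuple l) i.
have expE x : expansion l x = \sum_(i < n) dotp x (e i) *: e i.
  by rewrite /expansion big_tnth.
have bPK : bounded_op (fun x => expansion l (K x)).
  rewrite (_ : (fun x => _) = (fun x => \sum_(i < n) dotp (K x) (e i) *: e i)).
    by apply: bounded_sum => i; exact: bounded_rank_one.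
  by apply/funext => x; rewrite expE.
have bS := bounded_sub bK bPK; set S := (fun x => _ - _) in bS.
have lS := bounded_lin bS.
have lT : linear (fun x => x + S x) by case: (bounded_add (bounded_id X) bS).
have below x : rnorm x <= 2 * rnorm (x + S x).
  have := rnormB (x + S x) (S x); rewrite addrK.
  by have := hl x; rewrite -/(S x); lra.
have [/invertibleP[]] := invertible_of_bounded_below lT (contraction_onto lS hl) below.
set Q := inv_op _ => bQ QK SK _; have lQ := bounded_lin bQ.
pose phi (j : 'I_n) x := dotp (K x) (e j).
have phiD j x y : phi j (x - y) = phi j x - phi j y by rewrite /phi (linB lK) dotpBl.
have phi_sum j (f : 'I_n -> R[i]) :
    phi j (\sum_(i < n) f i *: Q (e i)) = \sum_(i < n) f i * phi j (Q (e i)).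
  rewrite /phi (lin_sum lK); elim/big_ind2 : _ => [|u1 u2 v1 v2 h1 h2|i _].
  - by rewrite dotp0l.
  - by rewrite dotpDl h1 h2.
  - by rewrite (linZ lK) dotpZl.
have AE x : x + K x = x + S x + \sum_(i < n) phi i x *: e i.
  by rewrite -addrA /S expE subrK.
(* With x = Q y - sum_i xi_i Q e_i, the equation x + K x = y becomes
   xi M = (phi_j (Q y))_j, where xi_i stands for phi_i x. *)
pose M : 'M[R[i]]_n := 1%:M + \matrix_(i, j) phi j (Q (e i)).
have ME (xi : 'rV[R[i]]_n) j :
    (xi *m M) 0 j = xi 0 j + \sum_(i < n) xi 0 i * phi j (Q (e i)).
  rewrite mulmxDr mulmx1 mxE; congr (_ + _); rewrite mxE.
  by apply: eq_bigr => i _; rewrite mxE.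
have SQ (f : 'I_n -> R[i]) : let v := \sum_(i < n) f i *: Q (e i) in
    v + S v = \sum_(i < n) f i *: e i.
  rewrite /= (lin_sum lT); apply: eq_bigr => i _.
  by rewrite (linZ lT) SK.
have Mu : M \in unitmx.
  rewrite -row_free_unit; apply: inj_row_free => xi hxi.
  pose v := \sum_(i < n) xi 0 i *: Q (e i).
  have phiv j : phi j v = - xi 0 j.
    by apply/eqP; rewrite -addr_eq0 addrC phi_sum -ME hxi mxE.
  have v0 : v = 0.
    apply: inj; rewrite AE SQ -big_split big1// => i _ /=.
    by rewrite phiv -scalerDl subrr scale0r.
  apply/rowP => j; apply/eqP; rewrite mxE -oppr_eq0 -phiv v0.
  by rewrite /phi (lin0 lK) dotp0l.
pose xi y : 'rV[R[i]]_n := (\row_j phi j (Q y)) *m invmx M.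
pose B y := Q y - \sum_(i < n) xi y 0 i *: Q (e i).
apply: (@invertible_of_right_inverse _ _ _ _ B) => //.
  apply: bounded_sub => //; apply: bounded_sum => i.
  rewrite (_ : (fun x => _) =
      (fun y => \sum_(j < n) invmx M j i *: (phi j (Q y) *: Q (e i)))).
    apply: bounded_sum => j; apply: bounded_scale; apply: bounded_rank_one.
    exact: bounded_comp.
  apply/funext => y; rewrite mxE scaler_suml; apply: eq_bigr => j _.
  by rewrite mxE scalerA mulrC.
move=> y; have xiM : xi y *m M = \row_j phi j (Q y) by rewrite mulmxKV.
have phiB j : phi j (B y) = xi y 0 j.
  rewrite phiD phi_sum; apply/eqP; rewrite subr_eq -ME xiM mxE; exact: eqxx.
rewrite AE (linB lT) SK SQ -[RHS]addr0 -addrA; congr (_ + _).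
rewrite addrC -sumrB big1// => i _.
by rewrite phiB subrr.
Qed.

End Fredholm.

(** * Operator-valued power series *)

Section PowerSeries.
Context {R : realType}.
Implicit Types (W X Y Z : hilbertType R) (c r : R[i]).

(** Analyticity with an explicit geometric bound on every remainder.  It
    implies [analytic_at], is stable under the operations needed, and its case
    n = 1 says that f r tends to its leading coefficient in norm. *)
Definition power_series_at X Y (f : R[i] -> X -> Y) c : Prop :=
  exists (a : nat -> X -> Y) (M q rho : R),
  [/\ forall k, bounded_op (a k), 0 <= M, 0 < q, 0 < rho &
    forall r, cabs (r - c) < rho -> forall n x,
      rnorm (f r x - \sum_(k < n) (r - c) ^+ k *: a k x)
        <= M * (q * cabs (r - c)) ^+ n * rnorm x].

Lemma analytic_of_ps X Y (f : R[i] -> X -> Y) c : power_series_at f c -> analytic_at f c.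
Proof.
move=> [a [M [q [rho [ba M0 q0 rho0 hf]]]]]; exists a; split=> //.
exists (Num.min rho (2 * q)^-1).
  by rewrite lt_min rho0 invr_gt0 mulr_gt0.
move=> r; rewrite cabs_lt lt_min => /andP[r1 r2] eps eps0.
have hq : q * cabs (r - c) <= 2^-1.
  have : cabs (r - c) * (2 * q) <= 1 by rewrite -ler_pdivlMr ?mulr_gt0// div1r ltW.
  lra.
have M1 : 0 < M + 1 by rewrite ltr_wpDl.
have [n0 hn0] := small_invS (divr_gt0 eps0 M1).
exists n0 => n hn x; apply: le_trans (hf r r1 n x) _.
rewrite ler_wpM2r ?rnorm_ge0//.
apply: (@le_trans _ _ ((M + 1) * (eps / (M + 1)))); last first.
  by rewrite mulrC divfK// gt_eqF.
apply: ler_pM => //; first by rewrite exprn_ge0// mulr_ge0 ?cabs_ge0// ltW.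
  by rewrite lerDl.
apply: le_trans _ (hn0 _ hn); apply: le_trans _ (expr_half_le_invS _).
by rewrite lerXn2r ?nnegrE ?mulr_ge0 ?cabs_ge0 ?(ltW q0) ?invr_ge0.
Qed.

Lemma ps_ext X Y (f g : R[i] -> X -> Y) c (rho : R) : 0 < rho ->
  (forall r, cabs (r - c) < rho -> forall x, f r x = g r x) ->
  power_series_at f c -> power_series_at g c.
Proof.
move=> rho0 fg [a [M [q [rho' [ba M0 q0 rho0' hf]]]]].
exists a, M, q, (Num.min rho rho'); split=> //; first by rewrite lt_min rho0.
by move=> r; rewrite lt_min => /andP[r1 r2] n x; rewrite -fg// hf.
Qed.

Lemma ps_const X Y (U : X -> Y) c : bounded_op U -> power_series_at (fun _ => U) c.
Proof.
move=> bU; have [M M0 hM] := bounded_bound bU.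
exists (fun k => if k is 0%N then U else fun=> 0), M, 1, 1.
split; rewrite ?ltr01 ?(ltW M0)//; first by case=> [|k] //; exact: bounded_zero.
move=> r _ [|n] x; first by rewrite big_ord0 subr0 expr0 mulr1.
rewrite big_ord_recl expr0 scale1r big1 => [|i _]; last by rewrite scaler0.
by rewrite addr0 subrr rnorm0 !mulr_ge0 ?exprn_ge0 ?mulr_ge0 ?cabs_ge0 ?rnorm_ge0// ltW.
Qed.

Lemma ps_add X Y (f g : R[i] -> X -> Y) c :
  power_series_at f c -> power_series_at g c ->
  power_series_at (fun r x => f r x + g r x) c.
Proof.
move=> [a [M [q [rho [ba M0 q0 rho0 hf]]]]] [b [M' [q' [rho' [bb M0' q0' rho0' hg]]]]].
exists (fun k x => a k x + b k x), (M + M'), (q + q'), (Num.min rho rho').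
split; rewrite ?addr_ge0 ?addr_gt0 ?lt_min ?rho0//; first by move=> k; exact: bounded_add.
move=> r; rewrite lt_min => /andP[r1 r2] n x.
rewrite (_ : \sum_(k < n) _ = \sum_(k < n) (r - c) ^+ k *: a k x +
   \sum_(k < n) (r - c) ^+ k *: b k x); last first.
  by rewrite -big_split; apply: eq_bigr => k _; rewrite scalerDr.
rewrite opprD addrACA; apply: le_trans (rnormD _ _) _.
rewrite !mulrDl; apply: lerD.
  apply: le_trans (hf r r1 n x) _; rewrite ler_wpM2r ?rnorm_ge0// ler_wpM2l//.
  rewrite lerXn2r ?nnegrE ?addr_ge0 ?mulr_ge0 ?cabs_ge0 ?(ltW q0) ?(ltW q0')//.
  by rewrite lerDl mulr_ge0 ?cabs_ge0// ltW.
apply: le_trans (hg r r2 n x) _; rewrite ler_wpM2r ?rnorm_ge0// ler_wpM2l//.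
rewrite lerXn2r ?nnegrE ?addr_ge0 ?mulr_ge0 ?cabs_ge0 ?(ltW q0) ?(ltW q0')//.
by rewrite lerDr mulr_ge0 ?cabs_ge0// ltW.
Qed.

Lemma ps_comp W X Y Z (U : Y -> Z) (V : W -> X) (f : R[i] -> X -> Y) c :
  bounded_op U -> bounded_op V -> power_series_at f c ->
  power_series_at (fun r x => U (f r (V x))) c.
Proof.
move=> bU bV [a [M [q [rho [ba M0 q0 rho0 hf]]]]]; have lU := bounded_lin bU.
have [u u0 hu] := bounded_bound bU; have [v v0 hv] := bounded_bound bV.
exists (fun k x => U (a k (V x))), (u * M * v), q, rho.
split=> //; first by move=> k; apply: bounded_comp => //; exact: bounded_comp.
  by rewrite !mulr_ge0// ltW.
move=> r hr n x.
rewrite (_ : \sum_(k < n) _ = U (\sum_(k < n) (r - c) ^+ k *: a k (V x))); last first.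
  by rewrite (lin_sum lU); apply: eq_bigr => k _; rewrite (linZ lU).
rewrite -(linB lU); apply: le_trans (hu _) _.
rewrite -!mulrA ler_pM2l//; apply: le_trans (hf r hr n (V x)) _.
have p0 : 0 <= (q * cabs (r - c)) ^+ n by rewrite exprn_ge0// mulr_ge0 ?cabs_ge0// ltW.
by rewrite -mulrA ler_wpM2l// mulrCA ler_wpM2l// mulrC.
Qed.

Lemma bounded_scal X (a : R[i]) : bounded_op (fun x : X => a *: x).
Proof. exact: bounded_scale (bounded_id X). Qed.

Lemma ps_scale X Y (a : R[i]) (f : R[i] -> X -> Y) c :
  power_series_at f c -> power_series_at (fun r x => a *: f r x) c.
Proof. by move=> hf; exact: (ps_comp (bounded_scal Y a) (bounded_id X) hf). Qed.

Lemma ps_mulX X Y (f : R[i] -> X -> Y) c :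
  power_series_at f c -> power_series_at (fun r x => (r - c) *: f r x) c.
Proof.
move=> [a [M [q [rho [ba M0 q0 rho0 hf]]]]].
exists (fun k => if k is j.+1 then a j else fun=> 0), (rho * M + M / q), q, rho.
split=> //; first by case=> [|k] //; exact: bounded_zero.
  by rewrite addr_ge0 ?mulr_ge0 ?invr_ge0// ltW.
move=> r hr [|n] x.
  rewrite big_ord0 subr0 expr0 mulr1 rnormZ.
  have := hf r hr 0 x; rewrite big_ord0 subr0 expr0 mulr1 => h.
  apply: (@le_trans _ _ (rho * (M * rnorm x))).
    by apply: ler_pM; rewrite ?cabs_ge0 ?rnorm_ge0// ltW.
  by rewrite mulrA ler_wpM2r ?rnorm_ge0// lerDl mulr_ge0 ?invr_ge0// ltW.
rewrite big_ord_recl scaler0 add0r.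
rewrite (_ : \sum_(i < n) _ = (r - c) *: \sum_(k < n) (r - c) ^+ k *: a k x); last first.
  by rewrite scaler_sumr; apply: eq_bigr => k _; rewrite scalerA exprS.
rewrite -scalerBr rnormZ.
have p0 : 0 <= (q * cabs (r - c)) ^+ n by rewrite exprn_ge0// mulr_ge0 ?cabs_ge0// ltW.
apply: (@le_trans _ _ (cabs (r - c) * (M * (q * cabs (r - c)) ^+ n * rnorm x))).
  by rewrite ler_wpM2l ?cabs_ge0// hf.
rewrite mulrA ler_wpM2r ?rnorm_ge0// mulrA exprS mulrA ler_wpM2r//.
have -> : (rho * M + M / q) * (q * cabs (r - c)) =
    rho * M * (q * cabs (r - c)) + cabs (r - c) * M.
  by field; rewrite gt_eqF.
rewrite lerDr.
by rewrite !mulr_ge0 ?cabs_ge0// ltW.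
Qed.

Lemma ps_mulr X Y (f : R[i] -> X -> Y) c :
  power_series_at f c -> power_series_at (fun r x => r *: f r x) c.
Proof.
move=> hf; apply: (ps_ext (ltr01 : 0 < 1 :> R)) (ps_add (ps_scale c hf) (ps_mulX hf)).
by move=> r _ x; rewrite -scalerDl addrC subrK.
Qed.

Lemma ps_expX X Y (f : R[i] -> X -> Y) c n :
  power_series_at f c -> power_series_at (fun r x => (r - c) ^+ n *: f r x) c.
Proof.
move=> hf; elim: n => [|n IH].
  by apply: (ps_ext (ltr01 : 0 < 1 :> R)) hf => r _ x; rewrite scale1r.
apply: (ps_ext (ltr01 : 0 < 1 :> R)) (ps_mulX IH) => r _ x.
by rewrite scalerA exprS.
Qed.

Lemma ps_expr X Y (f : R[i] -> X -> Y) c n :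
  power_series_at f c -> power_series_at (fun r x => r ^+ n *: f r x) c.
Proof.
move=> hf; elim: n => [|n IH].
  by apply: (ps_ext (ltr01 : 0 < 1 :> R)) hf => r _ x; rewrite scale1r.
apply: (ps_ext (ltr01 : 0 < 1 :> R)) (ps_mulr IH) => r _ x.
by rewrite scalerA exprS.
Qed.

Lemma ps_sum X Y c n (f : 'I_n -> R[i] -> X -> Y) :
  (forall i, power_series_at (f i) c) ->
  power_series_at (fun r x => \sum_(i < n) f i r x) c.
Proof.
elim: n f => [f _|n IH f hf].
  apply: (ps_ext (ltr01 : 0 < 1 :> R)) (ps_const c (bounded_zero X Y)) => r _ x.
  by rewrite big_ord0.
have h1 : power_series_at
    (fun r x => \sum_(i < n) f (widen_ord (leqnSn n) i) r x) c by apply: IH.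
apply: (ps_ext (ltr01 : 0 < 1 :> R)) (ps_add h1 (hf ord_max)) => r _ x.
by rewrite big_ord_recr.
Qed.

(** The Neumann series.  Its n-th remainder is
    s^n (A + s B)^-1 (- B A^-1)^n with s = r - c. *)
Lemma ps_perturbation X (A B : X -> X) c :
  bounded_op A -> invertible_op A -> bounded_op B ->
  power_series_at (fun r => inv_op (fun x => A x + (r - c) *: B x)) c.
Proof.
move=> bA iA bB; have [rho [C [rho0 C0 hinv]]] := invertible_perturbation bA iA bB.
have [bV VK AK] := invertibleP iA; set V := inv_op A in bV VK AK.
pose D x := - B (V x).
have bD : bounded_op D.
  have := bounded_scale (-1) (bounded_comp bB bV).
  by rewrite (_ : (fun x => _) = D)//; apply/funext => x; rewrite scaleN1r.
have [d d0 hd] := bounded_bound bD.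
exists (fun k x => V (iter k D x)), C, d, rho; split; rewrite ?ltW//.
  by move=> k; apply: bounded_comp => //; exact: bounded_iter.
move=> r hr n y; have [/invertibleP[bI IK KI] hC] := hinv _ hr.
set I := inv_op _ in bI IK KI hC *; have lI := bounded_lin bI.
have step z : I z - V z = (r - c) *: I (D z).
  rewrite -(linZ lI) -{1}(IK (V z)) -(linB lI); congr (I _).
  by rewrite /= AK opprD addrA subrr add0r scalerN.
have -> : I y - \sum_(k < n) (r - c) ^+ k *: V (iter k D y) =
    (r - c) ^+ n *: I (iter n D y).
  elim: n => [|n IH]; first by rewrite big_ord0 subr0 scale1r.
  rewrite big_ord_recr opprD addrA IH -scalerBr step scalerA -exprSr.
  by [].
have hDn : rnorm (iter n D y) <= d ^+ n * rnorm y.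
  elim: n => [|n IH]; first by rewrite mul1r.
  by apply: le_trans (hd _) _; rewrite exprS -mulrA ler_pM2l.
rewrite rnormZ cabsX exprMn.
apply: (@le_trans _ _ (cabs (r - c) ^+ n * (C * (d ^+ n * rnorm y)))).
  rewrite ler_wpM2l ?exprn_ge0 ?cabs_ge0//; apply: le_trans (hC _) _.
  by rewrite ler_pM2l.
by rewrite le_eqVlt; apply/orP; left; apply/eqP; ring.
Qed.

(** The leading coefficient is the limit of f along the real direction, so it
    vanishes when N > 0; then divide by r - c and repeat. *)
Lemma ps_divide X Y (N : nat) (f : R[i] -> X -> Y) c (B rho : R) :
  power_series_at f c -> 0 < rho -> 0 <= B ->
  (forall t : R, 0 < t < rho -> forall x,
     rnorm (f (c + t%:C) x) <= B * t ^+ N * rnorm x) ->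
  exists g, power_series_at g c /\ exists2 sig : R, 0 < sig &
    forall r, 0 < cabs (r - c) < sig -> forall x, f r x = (r - c) ^+ N *: g r x.
Proof.
elim: N f => [|N IH] f hf rho0 B0 hB.
  by exists f; split=> //; exists 1 => // r _ x; rewrite scale1r.
move: (hf) => [a [M [q [rho' [ba M0 q0 rho0' ha]]]]].
have a0 x : a 0%N x = 0.
  apply: rnorm_le_eps => eps eps0; rewrite subr0.
  pose C := (B + M * q) * rnorm x + 1.
  have C0 : 0 < C by rewrite ltr_wpDl// mulr_ge0 ?rnorm_ge0 ?addr_ge0 ?mulr_ge0// ltW.
  pose t := Num.min (Num.min rho rho' / 2) (Num.min 1 (eps / C)).
  have t0 : 0 < t by rewrite !lt_min divr_gt0 ?divr_gt0 ?lt_min ?rho0 ?ltr01.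
  have tr : t <= Num.min rho rho' / 2 by rewrite ge_min lexx.
  have t1 : t <= 1 by rewrite !ge_min lexx !orbT.
  have te : t <= eps / C by rewrite !ge_min lexx !orbT.
  have tm : t < Num.min rho rho'.
    apply: le_lt_trans tr _; rewrite ltr_pdivrMr// ltr_pMr ?ltr1n//.
    by rewrite lt_min rho0.
  move: tm; rewrite lt_min => /andP[tr1 tr2].
  have e : c + t%:C - c = t%:C by rewrite addrC addKr.
  have h1 := hB t (introT andP (conj t0 tr1)) x.
  have := ha (c + t%:C) _ 1%N x; rewrite e cabsC ?(ltW t0)// => /(_ tr2).
  rewrite big_ord_recl big_ord0 expr0 scale1r addr0 expr1 rnormBC => h2.
  have h3 := rnormD (a 0%N x - f (c + t%:C) x) (f (c + t%:C) x).
  rewrite subrK in h3; apply: le_trans h3 _.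
  apply: le_trans (lerD h2 h1) _.
  have h4 : B * t ^+ N.+1 * rnorm x <= B * t * rnorm x.
    rewrite ler_wpM2r ?rnorm_ge0// ler_wpM2l// exprS -[leRHS]mulr1.
    by rewrite ler_pM2l// exprn_ile1// ltW.
  apply: le_trans (lerD (lexx _) h4) _.
  have : t * C <= eps by rewrite -ler_pdivlMr.
  by rewrite /C; move: (rnorm x) t0 => w; nra.
pose g r x := if r == c then a 1%N x else (r - c)^-1 *: f r x.
have fg r x : r != c -> f r x = (r - c) *: g r x.
  by move=> rc; rewrite /g (negbTE rc) scalerA divff ?scale1r// subr_eq0.
have hg : power_series_at g c.
  have [b b0 hb] := bounded_bound (ba 1%N).
  exists (fun k => a k.+1), (M * q + b), q, rho'; split=> //.
    by rewrite addr_ge0 ?mulr_ge0// ltW.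
  move=> r hr n x; have p0 : 0 <= (q * cabs (r - c)) ^+ n.
    by rewrite exprn_ge0// mulr_ge0 ?cabs_ge0// ltW.
  have [rc|rc] := eqVneq r c.
    rewrite /g rc eqxx subrr cabs0 mulr0; case: n {p0} => [|n].
      rewrite big_ord0 subr0 expr0 mulr1; apply: le_trans (hb x) _.
      by rewrite ler_wpM2r ?rnorm_ge0// lerDr mulr_ge0// ltW.
    rewrite big_ord_recl expr0 scale1r big1 => [|i _]; last by rewrite expr0n /= scale0r.
    by rewrite addr0 subrr rnorm0 expr0n /= mulr0 mul0r.
  have s0 : 0 < cabs (r - c) by rewrite cabs_gt0 subr_eq0.
  have := ha r hr n.+1 x; rewrite big_ord_recl a0 scaler0 add0r (fg r x rc).
  rewrite (_ : \sum_(i < n) _ = (r - c) *: \sum_(k < n) (r - c) ^+ k *: a k.+1 x); last first.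
    by rewrite scaler_sumr; apply: eq_bigr => k _; rewrite scalerA exprS.
  rewrite -scalerBr rnormZ exprS => h.
  rewrite -(ler_pM2l s0); apply: le_trans h _.
  have : 0 <= cabs (r - c) * (b * (q * cabs (r - c)) ^+ n * rnorm x).
    by rewrite !mulr_ge0 ?cabs_ge0 ?rnorm_ge0// ltW.
  by move: ((q * cabs (r - c)) ^+ n) => w; lra.
have [|g' [hg' [sig sig0 hs]]] := IH g hg rho0 B0.
  move=> t /andP[t0 tr] x; have tc : c + t%:C != c.
    by rewrite -subr_eq0 addrC addKr -cabs_gt0 cabsC// ltW.
  have := hB t _ x; rewrite t0 tr => /(_ isT).
  rewrite (fg _ _ tc) rnormZ addrC addKr cabsC ?(ltW t0)// exprS.
  move=> h; rewrite -(ler_pM2l t0); apply: le_trans h _.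
  by rewrite le_eqVlt; apply/orP; left; apply/eqP; ring.
exists g'; split=> //; exists sig => // r hr x.
have rc : r != c by rewrite -subr_eq0 -cabs_gt0; case/andP: hr.
by rewrite fg// hs// scalerA exprS.
Qed.

End PowerSeries.

(** * The Riesz decomposition and the poles of the inverse *)

Section RieszTheory.
Context {R : realType} {X : hilbertType R}.

Lemma closed_kernel (Y : hilbertType R) (T : X -> Y) :
  bounded_op T -> closed_subspace (fun x => T x = 0).
Proof.
move=> bT; have lT := bounded_lin bT; have [c c0 hc] := bounded_bound bT.
split=> [|a x y hx hy|x hx]; first exact: lin0.
  by rewrite lT hx hy scaler0 addr0.
apply: rnorm_le_eps => e e0; rewrite subr0.
have [y hy hxy] := hx _ (divr_gt0 e0 c0).
rewrite -[T x]subr0 -hy -(linB lT); apply: le_trans (hc _) _.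
by rewrite -ler_pdivlMl// mulrC.
Qed.

Lemma orthogonal_projector (N : X -> Prop) : closed_subspace N ->
  exists P : X -> X, [/\ bounded_op P, forall x, N (P x), forall x, N x -> P x = x &
    forall x z, N z -> dotp (x - P x) z = 0].
Proof.
move=> cN; have [N0 Nl _] := cN.
have /choice[P hP] (x : X) : exists p, N p /\ forall z, N z -> dotp (x - p) z = 0.
  by have [p ? ?] := projection_exists x cN; exists p.
have NB x y : N x -> N y -> N (x - y).
  by move=> hx hy; have := Nl (-1) _ _ hy hx; rewrite scaleN1r addrC.
have uniq x p : N p -> (forall z, N z -> dotp (x - p) z = 0) -> P x = p.
  move=> Np hp; apply/subr0_eq/rnorm_le0/ler_rnorm2; rewrite ?lexx//.
  have Nd : N (P x - p) by apply: NB => //; case: (hP x).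
  rewrite expr0n -lecR -dotpxx.
  have -> : P x - p = (x - p) - (x - P x) by rewrite opprB [RHS]addrC addrA subrK.
  rewrite dotpBl (_ : x - p - (x - P x) = P x - p).
    by rewrite (hp _ Nd) (hP x).2// subrr.
  by rewrite opprB addrC addrA subrK.
exists P; split=> [|x|x Nx|x z Nz].
- split=> [a x y|].
    apply: uniq; first by apply: Nl; case: (hP x); case: (hP y).
    move=> z Nz; rewrite opprD addrACA -scalerBr dotpDl dotpZl.
    by rewrite (hP x).2// (hP y).2// mulr0 addr0.
  exists 1 => x; rewrite mul1r; apply: ler_rnorm2; first exact: rnorm_ge0.
  have := @pythagoras _ _ (x - P x) (P x); rewrite subrK => ->.
    by rewrite lerDr sqr_ge0.
  by rewrite (hP x).2//; case: (hP x).
- by case: (hP x).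
- by apply: uniq => // z _; rewrite subrr dotp0l.
- by rewrite (hP x).2.
Qed.

(** Unit vectors e_n in ker A^(n+1), orthogonal to ker A^n, would have images
    under the compact operator A - 1 at mutual distance at least 1. *)
Lemma finite_ascent (B : X -> X) : bounded_op B -> totally_bounded_op B ->
  let A x := x + B x in
  exists m, forall x, iter m.+1 A x = 0 -> iter m A x = 0.
Proof.
move=> bB tB A; have bA : bounded_op A by exact: bounded_add (bounded_id X) bB.
have bAn n := bounded_iter n bA; have lAn n := bounded_lin (bAn n).
apply: contrapT => hne.
have /choice[e he] (n : nat) : exists e : X,
    [/\ rnorm e = 1, iter n.+1 A e = 0 & forall z, iter n A z = 0 -> dotp e z = 0].
  have [x [hx1 hx2]] : exists x, iter n.+1 A x = 0 /\ iter n A x <> 0.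
    apply: contrapT => h; apply: hne; exists n => x hx.
    by apply: contrapT => hx'; apply: h; exists x.
  have [p hp orth] := projection_exists x (closed_kernel (bAn n)).
  have xp : x - p != 0.
    by apply/eqP => h; apply: hx2; rewrite -(subrK p x) h add0r.
  have r0 := xp; rewrite -rnorm_gt0 in r0.
  exists ((rnorm (x - p))%:C^-1 *: (x - p)); split.
  - by rewrite rnormZ cabsV cabsC ?(ltW r0)// mulVf// gt_eqF.
  - rewrite (linZ (lAn _)) (linB (lAn _)) hx1 iterS hp (lin0 (bounded_lin bA)).
    by rewrite subr0 scaler0.
  - by move=> z hz; rewrite dotpZl orth// mulr0.
have killed i j : (i < j)%N -> iter j A (e i) = 0.
  move=> ij; rewrite -(subnK ij) iterD; case: (he i) => _ -> _.
  exact: (lin0 (lAn _)).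
have sep i j : (i < j)%N -> 1 <= rnorm (B (e j) - B (e i)).
  move=> ij; have [ej1 ej2 ej3] := he j.
  pose w := A (e j) - A (e i) + e i.
  have -> : B (e j) - B (e i) = w - e j.
    by rewrite /w /A opprD addrACA [_ + _ + e i]addrAC subrK [RHS]addrC addKr.
  have hw : iter j A w = 0.
    have h1 : iter j A (A (e j)) = 0 by rewrite -iterSr.
    have h2 : iter j A (A (e i)) = 0 by rewrite -iterSr; apply/killed/ltnW.
    by rewrite (linD (lAn _)) (linB (lAn _)) h1 h2 killed// subrr addr0.
  rewrite -(@ler_pXn2r _ 2) ?nnegrE ?rnorm_ge0// rnormB2 ej1 expr1n.
  by rewrite (dotp_eq0C (ej3 _ hw)) /= mulr0 subr0 lerDr sqr_ge0.
(* Two of the vectors B e_n within 1/3 of the same point of a net would be at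
   distance at most 2/3 from each other. *)
have [s hs] := tB 3^-1 ltac:(by rewrite invr_gt0).
have /choice[y hy] (n : nat) : exists y, y \in s /\ rnorm (B (e n) - y) <= 3^-1.
  by have [|y ys ?] := hs (e n); [by case: (he n) => -> | exists y].
pose g (i : 'I_(size s).+1) : 'I_(size s) :=
  Ordinal (etrans (index_mem _ _) (hy i).1).
have /injectivePn[i [j ij gij]] : ~~ injectiveb g.
  apply/negP => /injectiveP /leq_card; rewrite !card_ord ltnn.
  by [].
have yij : y i = y j.
  have /(congr1 val) /= h := gij.
  by rewrite -(nth_index 0 (hy i).1) h nth_index// (hy j).1.
have close : rnorm (B (e j) - B (e i)) < 1.
  apply: le_lt_trans (rnorm_tri (y j) _ _) _.
  have := (hy j).2; have := (hy i).2; rewrite yij [rnorm (y j - _)]rnormBC; lra.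
have close' : rnorm (B (e i) - B (e j)) < 1 by rewrite rnormBC.
have := ij; rewrite -val_eqE neq_ltn => /orP[] /sep.
  by rewrite leNgt close.
by rewrite leNgt close'.
Qed.


Lemma tb_iter_sub_id (B : X -> X) n : bounded_op B -> totally_bounded_op B ->
  totally_bounded_op (fun x => iter n (fun x => x + B x) x - x).
Proof.
move=> bB tB; set A := fun x => x + B x.
have bA : bounded_op A by exact: bounded_add (bounded_id X) bB.
elim: n => [|n IH].
  by move=> eps e0; exists [:: 0] => x _; exists 0; rewrite ?inE// subrr subr0 rnorm0 ltW.
have -> : (fun x => iter n.+1 A x - x) = (fun x => A (iter n A x - x) + B x).
  apply/funext => x; rewrite (linB (bounded_lin bA)) iterS.
  by rewrite -[RHS]addrA {3}/A opprD addrNK.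
exact: (tb_add (tb_compl bA IH) tB).
Qed.

(** The Riesz decomposition: Pi projects onto the generalized kernel N of
    A = 1 + B along a complement on which A is invertible.  With P the
    orthogonal projection onto N = ker A^m, the operator A^m + P is injective,
    hence invertible, and is the identity on N; this gives
    Pi = P (A^m + P)^-1. *)
Lemma riesz_decomposition (B : X -> X) : bounded_op B -> totally_bounded_op B ->
  let A x := x + B x in
  exists m (Pi : X -> X), [/\ bounded_op Pi, forall x, Pi (Pi x) = Pi x,
    forall x, Pi (A x) = A (Pi x), forall x, iter m A (Pi x) = 0 &
    invertible_op (fun x => A (x - Pi x) + Pi x)].
Proof.
move=> bB tB A; have [m0 asc] := finite_ascent bB tB; rewrite -/A in asc.
have bA : bounded_op A by exact: bounded_add (bounded_id X) bB.
have lA := bounded_lin bA; have lB := bounded_lin bB.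
pose m := m0.+1; have bAm := bounded_iter m bA; have lAm := bounded_lin bAm.
have asc_add k x : iter (m0 + k) A x = 0 -> iter m0 A x = 0.
  elim: k => [|k IH]; first by rewrite addn0.
  by rewrite addnS -addSn iterD => /asc; rewrite -iterD => /IH.
have stable x : iter m A (iter m A x) = 0 -> iter m A x = 0.
  rewrite -iterD {1}/m addSnnS => /asc_add h.
  by rewrite iterS h (lin0 lA).
have [P [bP NP Pid _]] := orthogonal_projector (closed_kernel bAm).
have lP := bounded_lin bP.
have iL : invertible_op (fun x => iter m A x + P x).
  have -> : (fun x => iter m A x + P x) = (fun x => x + ((iter m A x - x) + P x)).
    by apply/funext => x; rewrite addrA [x + _]addrC subrK.
  apply: fredholm_alternative.
  - apply: bounded_add => //; apply: bounded_sub => //; exact: bounded_id.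
  - apply: tb_add; first exact: tb_iter_sub_id.
    have -> : P = (fun x => (-1) *: (iter m A (P x) - P x)).
      by apply/funext => x; rewrite NP sub0r scaleN1r opprK.
    apply: tb_compl; first exact: bounded_scal.
    have bd : bounded_op (fun x => iter m A x - x).
      by apply: bounded_sub => //; exact: bounded_id.
    exact: (tb_compr (bounded_lin bd) bP (tb_iter_sub_id m bB tB)).
  - move=> x; rewrite addrA [x + _]addrC subrK => hx.
    have Nx : iter m A x = 0.
      apply: stable; have -> : iter m A x = - P x by apply/eqP; rewrite -addr_eq0 hx.
      by rewrite (linN lAm) NP oppr0.
    by move: hx; rewrite Nx add0r Pid.
have [bLi LiK LK] := invertibleP iL; set Li := inv_op _ in bLi LiK LK.
have lLi := bounded_lin bLi.
have LiN z : iter m A z = 0 -> Li z = z.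
  by move=> Nz; rewrite -{1}[z](_ : iter m A z + P z = z) ?LiK// Nz add0r Pid.
pose Pi x := P (Li x).
have bPi : bounded_op Pi by exact: bounded_comp.
have lPi := bounded_lin bPi.
have PiN z : iter m A z = 0 -> Pi z = z by move=> Nz; rewrite /Pi LiN// Pid.
have NPi x : iter m A (Pi x) = 0 by exact: NP.
have PiA x : Pi (iter m A x) = 0.
  have {1}-> : iter m A x = (iter m A x + P x) - P x by rewrite addrK.
  by rewrite /Pi (linB lLi) LiK (LiN _ (NP _)) (linB lP) (Pid _ (NP _)) subrr.
have comm x : Pi (A x) = A (Pi x).
  have {1}-> : x = iter m A (Li x) + Pi x by rewrite /Pi LK.
  rewrite (linD lA) (linD lPi) -iterS iterSr PiA add0r PiN//.
  by rewrite -iterSr iterS NPi (lin0 lA).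
exists m, Pi; split=> // [x|]; first by rewrite PiN.
have -> : (fun x => A (x - Pi x) + Pi x) = (fun x => x + B (x - Pi x)).
  by apply/funext => x; rewrite /A addrAC subrK.
have bQ : bounded_op (fun x => x - Pi x) by apply: bounded_sub => //; exact: bounded_id.
apply: fredholm_alternative; [exact: bounded_comp | exact: tb_compr |].
move=> x; have -> : x + B (x - Pi x) = A (x - Pi x) + Pi x by rewrite /A addrAC subrK.
move=> hx; have Pix : Pi x = 0.
  have := congr1 Pi hx; rewrite (linD lPi) comm (linB lPi) (PiN _ (NPi x)) subrr.
  by rewrite (lin0 lA) add0r (lin0 lPi).
move: hx; rewrite Pix subr0 addr0 => Ax.
by rewrite -Pix PiN// /m iterSr Ax (lin0 (bounded_lin (bounded_iter _ bA))).
Qed.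

Lemma inverse_analytic (K : X -> X) (c : R[i]) : bounded_op K ->
  invertible_op (fun x => x + c *: K x) ->
  power_series_at (fun r => inv_op (fun x => x + r *: K x)) c /\
  exists2 rho : R, 0 < rho & forall r : R[i], cabs (r - c) < rho ->
    invertible_op (fun x => x + r *: K x).
Proof.
move=> bK iA; have bA : bounded_op (fun x => x + c *: K x).
  exact: bounded_add (bounded_id X) (bounded_scale c bK).
have e r : (fun x => x + c *: K x + (r - c) *: K x) = (fun x => x + r *: K x).
  by apply/funext => x; rewrite -addrA -scalerDl [c + _]addrC subrK.
split.
  apply: (ps_ext (ltr01 : 0 < 1 :> R)) (ps_perturbation c bA iA bK) => r _ x.
  by rewrite e.
have [rho [C [rho0 _ h]]] := invertible_perturbation bA iA bK.
by exists rho => // r /h[]; rewrite e.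
Qed.

(** The geometric sum inverting r A - s on the kernel of A^m, up to the factor
    - s^m. *)
Lemma telescope_nilpotent (A : X -> X) (r s : R[i]) m z : linear A ->
  iter m A z = 0 ->
  let p := \sum_(j < m) (r ^+ j * s ^+ (m.-1 - j)) *: iter j A z in
  r *: A p - s *: p = - s ^+ m *: z.
Proof.
move=> lA hz /=; rewrite (lin_sum lA) !scaler_sumr -sumrB.
pose T j := (r ^+ j * s ^+ (m - j)) *: iter j A z.
rewrite (eq_bigr (fun j : 'I_m => T j.+1 - T j)) => [|j _].
  rewrite -(big_mkord predT (fun j => T j.+1 - T j)) telescope_sumr//.
  by rewrite /T hz scaler0 sub0r subn0 expr0 mul1r scaleNr.
rewrite (linZ lA) /T !scalerA iterS; congr (_ *: _ - _ *: _).
  by rewrite mulrA -exprS -subn1 -subnDA add1n.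
rewrite mulrCA -exprS; congr (_ * _ ^+ _).
by rewrite -subn1 -subnDA add1n subnSK.
Qed.

(** Write A = 1 + c K, s = r - c, and decompose the space with Pi as above.
    The operator W = A (1 - Pi) + Pi agrees with A on the range of 1 - Pi, so
    1 + r K = A + s K is inverted there by (W + s K)^-1, which is analytic in s
    because W is invertible.  On the range of Pi, where A is nilpotent,
    c (1 + r K) = r A - s is inverted by a geometric sum. *)
Lemma inverse_meromorphic (K : X -> X) (c : R[i]) :
  bounded_op K -> totally_bounded_op K ->
  exists m g, power_series_at g c /\ exists2 rho : R, 0 < rho &
    forall r : R[i], 0 < cabs (r - c) < rho ->
      invertible_op (fun x => x + r *: K x) /\
      forall x, inv_op (fun x => x + r *: K x) x = (r - c) ^- m *: g r x.
Proof.
move=> bK tK; have lK := bounded_lin bK.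
have [->|c0] := eqVneq c 0.
  have [|h1 [rho rho0 h2]] := @inverse_analytic K 0 bK.
    exists (fun x => x); split=> [|x|x]; rewrite ?scale0r ?addr0//; exact: bounded_id.
  exists 0%N, (fun r => inv_op (fun x => x + r *: K x)); split=> //.
  by exists rho => // r /andP[_ hr]; split=> [|x];
    [exact: h2 | rewrite expr0 invr1 scale1r].
have bB := bounded_scale c bK.
have tB := tb_compl (bounded_scal X c) tK.
have [m [Pi [bPi idPi comm nil iW]]] := riesz_decomposition bB tB.
set A := fun x => x + c *: K x in comm nil iW.
have bA : bounded_op A by exact: bounded_add (bounded_id X) bB.
have lA := bounded_lin bA; have lPi := bounded_lin bPi.
have bQ : bounded_op (fun x => x - Pi x) by apply: bounded_sub => //; exact: bounded_id.
have KE x : K x = c^-1 *: (A x - x) by rewrite /A addrC addKr scalerK.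
have commK x : Pi (K x) = K (Pi x).
  by rewrite !KE (linZ lPi) (linB lPi) comm.
set W := fun x => _ in iW.
have bW : bounded_op W by exact: bounded_add (bounded_comp bA bQ) bPi.
have [rho [C [rho0 C0 hI]]] := invertible_perturbation bW iW bK.
pose I r := inv_op (fun x => W x + (r - c) *: K x).
pose p r x := \sum_(j < m) (r ^+ j * (r - c) ^+ (m.-1 - j)) *: iter j A (Pi x).
pose g r x := (r - c) ^+ m *: I r (x - Pi x) + (- c) *: p r x.
have bp r : bounded_op (p r).
  apply: bounded_sum => j; apply: bounded_scale; apply: bounded_comp => //.
  exact: bounded_iter.
have hp : power_series_at p c.
  apply: ps_sum => j.
  have hj : power_series_at (fun _ x => iter j A (Pi x)) c.
    by apply: ps_const; apply: bounded_comp => //; exact: bounded_iter.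
  apply: (ps_ext (ltr01 : 0 < 1 :> R)) (ps_expr j (ps_expX (m.-1 - j) hj)) => r _ x.
  by rewrite scalerA.
exists m, g; split.
  apply: ps_add; last exact: ps_scale.
  apply: ps_expX; apply: (ps_comp (bounded_id X) bQ).
  exact: ps_perturbation.
exists rho => // r /andP[s0 hr].
have {}s0 : r - c != 0 by rewrite -cabs_gt0.
have [/invertibleP[bI IK KI] _] := hI _ hr; rewrite -/(I r) in bI IK KI.
have sm0 : (r - c) ^+ m != 0 by rewrite expf_eq0 (negbTE s0) andbF.
have bT : bounded_op (fun x => x + r *: K x).
  exact: bounded_add (bounded_id X) (bounded_scale r bK).
have lT := bounded_lin bT; have lI := bounded_lin bI.
have TE x : x + r *: K x = A x + (r - c) *: K x.
  by rewrite /A -addrA -scalerDl [c + _]addrC subrK.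
have cTE x : c *: (x + r *: K x) = r *: A x - (r - c) *: x.
  rewrite scalerDr scalerA [c * r]mulrC -scalerA scalerBl opprB addrA.
  by rewrite [RHS]addrAC -scalerBr addrC; congr (_ + _ *: _); rewrite /A addrC addKr.
have commT x : Pi (x + r *: K x) = Pi x + r *: K (Pi x).
  by rewrite (linD lPi) (linZ lPi) commK.
have WT y : Pi y = 0 -> W y + (r - c) *: K y = y + r *: K y.
  by move=> hy; rewrite /W hy subr0 addr0 TE.
have PiQ x : Pi (x - Pi x) = 0 by rewrite (linB lPi) idPi subrr.
have PiI x : Pi x = 0 -> Pi (I r x) = 0.
  move=> hx; have e y : Pi (W y + (r - c) *: K y) = W (Pi y) + (r - c) *: K (Pi y).
    rewrite (linD lPi) (linZ lPi) commK; congr (_ + _).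
    by rewrite /W (linD lPi) comm (linB lPi).
  have /= <- := IK (Pi (I r x)).
  by rewrite -e KI hx (lin0 lI).
pose S x := (r - c) ^- m *: g r x.
have SK : cancel S (fun x => x + r *: K x).
  move=> x; rewrite /S -[RHS](scalerK sm0) (linZ lT); congr (_ *: _).
  rewrite /g (linD lT) (linZ lT) -WT ?PiI// KI.
  have -> : (- c *: p r x) + r *: K (- c *: p r x) = (r - c) ^+ m *: Pi x.
    have /= -> := linZ lT (- c) (p r x); rewrite scaleNr cTE.
    by rewrite (telescope_nilpotent r (r - c) lA (nil x)) scaleNr opprK.
  by rewrite -scalerDr subrK.
have iT : invertible_op (fun x => x + r *: K x).
  apply: (invertible_of_right_inverse lT _ _ SK); last first.
    apply: bounded_scale; apply: bounded_add; last exact: bounded_scale.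
    by apply: bounded_scale; exact: bounded_comp.
  move=> x hx; have hz : Pi x + r *: K (Pi x) = 0 by rewrite -commT hx (lin0 lPi).
  have y0 : x - Pi x = 0.
    rewrite -[x - Pi x]IK WT// (linB lT) hx hz subrr.
    exact: (lin0 lI).
  have pow k : (r - c) ^+ k *: Pi x = r ^+ k *: iter k A (Pi x).
    elim: k => [|k IH]; first by rewrite !expr0.
    have := cTE (Pi x); rewrite hz scaler0 => /esym/subr0_eq h1.
    rewrite exprS -scalerA IH scalerA mulrC -scalerA iterS.
    have lAk := bounded_lin (bounded_iter k bA).
    by rewrite -(linZ lAk) -h1 (linZ lAk) scalerA -exprSr -iterSr iterS.
  rewrite (subr0_eq y0); apply/eqP.
  by have /eqP := pow m; rewrite nil scaler0 scaler_eq0 (negbTE sm0).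
split=> // x; have [_ TK _] := invertibleP iT.
by rewrite -{1}(SK x) TK.
Qed.

End RieszTheory.

(** * The scattering matrix *)

Section Scattering.
Context {R : realType} {X Y : hilbertType R}.
Context {T J : X -> X} {Z : X -> Y}.
Hypothesis bT : bounded_op T.
Hypothesis bJ : bounded_op J.
Hypothesis bZ : bounded_op Z.

Lemma dotp_sym_real (x y : X) : complex.Im (dotp x y) = 0 -> dotp y x = dotp x y.
Proof. by rewrite [dotp y x]dotp_conj; case: (dotp x y) => a b /= ->; simpc. Qed.

(** With w = J u and u + r T w = Z^* f one has S f = f - 2 pi i r Z w, whence
    |S f|^2 = |f|^2 - 4 pi r Im <f, Z w> + 4 pi^2 r^2 |Z w|^2.  As
    <f, Z w> = <u, J u> + r <T w, w>, the last two terms cancel. *)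
Lemma scattering_unitary (r : R) (f : Y) :
  (forall x, complex.Im (dotp (J x) x) = 0) ->
  (forall x, pi%:C *: adj Z (Z x) = im_op T x) ->
  scattering_domain T J r%:C ->
  rnorm (scattering_matrix T J Z r%:C f) = rnorm f.
Proof.
move=> realJ imT /invertibleP[_ _ KI]; rewrite /scattering_matrix.
have /= := KI (adj Z f); set u := inv_op _ _ => hu.
set w := J u in hu *.
have alphaE : 2 * pi%:C * 'i * r%:C = 0 +i* (2 * pi * r) :> R[i].
  rewrite (_ : 2 = (2 : R)%:C); last by rewrite rmorph_nat.
  by simpc.
have imTw : complex.Im (dotp (T w) w) = pi * rnorm (Z w) ^+ 2.
  have adjZ : dotp (adj Z (Z w)) w = (rnorm (Z w) ^+ 2)%:C.
    by rewrite dotp_conj -(adjP bZ) dotpxx conj_real.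
  have adjT : dotp (adj T w) w = (dotp (T w) w)^*.
    by rewrite dotp_conj -(adjP bT).
  have i2 : 2 * 'i != 0 :> R[i].
    by rewrite mulf_neq0 ?pnatr_eq0// eq_complex /= eqxx oner_eq0.
  have := congr1 (fun v => dotp v w) (imT w).
  rewrite /im_op !dotpZl dotpBl adjT adjZ subcJ => /(congr1 ( *%R (2 * 'i))).
  rewrite mulrA mulVKf//. 
  move=> h; apply: complexI; apply: (mulfI i2).
  by rewrite rmorphM [RHS]mulrA h complexiE mulrAC.
have fZw : complex.Im (dotp f (Z w)) = r * pi * rnorm (Z w) ^+ 2.
  rewrite dotp_conj (adjP bZ) -dotp_conj -hu dotpDl dotpZl.
  rewrite (dotp_sym_real (realJ u)).
  have ImD (a b : R[i]) : complex.Im (a + r%:C * b) = complex.Im a + r * complex.Im b.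
    by case: a => a1 a2; case: b => b1 b2; simpc.
  by rewrite ImD realJ imTw add0r mulrA.
apply/eqP; rewrite -(eqrXn2 (ltn0Sn 1) (rnorm_ge0 _) (rnorm_ge0 _)); apply/eqP.
rewrite rnormB2 rnormZ dotpZr alphaE exprMn.
have -> : cabs (0 +i* (2 * pi * r)) ^+ 2 = (2 * pi * r) ^+ 2 :> R.
  by apply: complexI; rewrite cabs2; simpc; rewrite /= expr2.
have -> : complex.Re ((0 +i* (2 * pi * r))^* * dotp f (Z w)) =
    2 * pi * r * complex.Im (dotp f (Z w)).
  by case: (dotp f (Z w)) => a b; simpc; rewrite /=; ring.
by rewrite fZw; ring.
Qed.

Hypothesis tT : totally_bounded_op T.

Lemma scattering_matrixE : scattering_matrix T J Z =
  fun r f => f - (2 * pi%:C * 'i) *: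
    (r *: Z (J (inv_op (fun x => x + r *: T (J x)) (adj Z f)))).
Proof. by apply/funext => r; apply/funext => f; rewrite scalerA. Qed.

(** The scattering matrix multiplied by (r - c)^n, with F in place of
    (r - c)^n (1 + r T J)^-1. *)
Lemma ps_scattering (F : R[i] -> X -> X) (n : nat) c : power_series_at F c ->
  power_series_at (fun r f => (r - c) ^+ n *: f -
        (2 * pi%:C * 'i) *: (r *: Z (J (F r (adj Z f))))) c.
Proof.
move=> hF.
have h1 := ps_expX n (ps_const c (bounded_id Y)).
have h2 := ps_comp (bounded_comp bZ bJ) (bounded_adj bZ) hF.
apply: (ps_ext (ltr01 : 0 < 1 :> R)) 
  (ps_add h1 (ps_scale (- (2 * pi%:C * 'i)) (ps_mulr h2))).
by move=> r _ x; rewrite scaleNr.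
Qed.

Lemma bounded_TJ : bounded_op (fun x => T (J x)).
Proof. exact: bounded_comp. Qed.

Lemma scattering_laurent c : exists m G, power_series_at G c /\
  exists2 rho : R, 0 < rho & forall r, 0 < cabs (r - c) < rho ->
    scattering_domain T J r /\
    forall f, scattering_matrix T J Z r f = (r - c) ^- m *: G r f.
Proof.
have tTJ := tb_compr (bounded_lin bT) bJ tT.
have [m [g [hg [rho rho0 h]]]] := inverse_meromorphic c bounded_TJ tTJ.
exists m, (fun r f => (r - c) ^+ m *: f -
        (2 * pi%:C * 'i) *: (r *: Z (J (g r (adj Z f))))); split.
  exact: ps_scattering.
exists rho => // r hr; have [iT invE] := h r hr; split=> // f.
have s0 : (r - c) ^+ m != 0.
  by apply: expf_neq0; rewrite -cabs_gt0; case/andP: hr.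
rewrite scattering_matrixE invE (linZ (bounded_lin bJ)) (linZ (bounded_lin bZ)).
rewrite scalerBr scalerK//; congr (_ - _).
by rewrite !scalerA; congr (_ *: _); ring.
Qed.

Lemma punctured_eq_of D (F G : R[i] -> Y -> Y) c (rho : R) : 0 < rho ->
  (forall r, 0 < cabs (r - c) < rho -> D r /\ forall f, F r f = G r f) ->
  punctured_eq D F G c.
Proof.
move=> rho0 h; exists rho => // r; rewrite cabs_lt normr_gt0 -cabs_gt0.
exact: h.
Qed.

Lemma scattering_meromorphic :
  meromorphic (scattering_domain T J) (scattering_matrix T J Z).
Proof.
split=> [c Dc|c].
  have [h _] := inverse_analytic bounded_TJ Dc.
  apply: analytic_of_ps; apply: (ps_ext (ltr01 : 0 < 1 :> R)) (ps_scattering 0 h).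
  by move=> r _ f; rewrite scattering_matrixE scale1r.
have [m [G [hG [rho rho0 h]]]] := scattering_laurent c.
exists m, G; split; first exact: analytic_of_ps.
exact: punctured_eq_of h.
Qed.

(** The isometry of S on the real axis bounds the numerator of its Laurent
    expansion by t^m at c + t, which removes the pole. *)
Lemma scattering_continues (r : R) :
  (forall x, complex.Im (dotp (J x) x) = 0) ->
  (forall x, pi%:C *: adj Z (Z x) = im_op T x) ->
  continues_analytically (scattering_domain T J) (scattering_matrix T J Z) r%:C.
Proof.
move=> realJ imT; have [m [G [hG [rho rho0 h]]]] := scattering_laurent r%:C.
have [|g [hg [sig sig0 hs]]] := ps_divide (N := m) hG rho0 ler01.
  move=> t /andP[t0 tr] f.
  have e : r%:C + t%:C - r%:C = t%:C by rewrite addrC addKr.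
  have [|D SE] := h (r%:C + t%:C); first by rewrite e cabsC ?(ltW t0)// t0.
  have -> : G (r%:C + t%:C) f = t%:C ^+ m *: scattering_matrix T J Z (r%:C + t%:C) f.
    by rewrite SE e scalerKV// expf_neq0// -cabs_gt0 cabsC// ltW.
  rewrite rnormZ cabsX cabsC ?(ltW t0)// mul1r -rmorphD scattering_unitary//.
  by rewrite rmorphD.
exists g; first exact: analytic_of_ps.
apply: (@punctured_eq_of _ _ _ _ (Num.min rho sig)); first by rewrite lt_min rho0.
move=> z; rewrite lt_min => /and3P[z0 z1 z2].
have [|D SE] := h z; first by rewrite z0.
by split=> // f; rewrite SE hs ?z0// scalerK// expf_neq0// -cabs_gt0.
Qed.

End Scattering.

Lemma sign_form_real (R : realType) (X : hilbertType R) (V J : X -> X) :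
  is_sign V J -> forall x, complex.Im (dotp (J x) x) = 0.
Proof.
move=> [_ [E [mu [_ hJ]]]] x; have [_ _ ->] := hJ x.
have -> : (fun t : R => complex.Im (sign_fun t)) = (fun=> 0).
  by apply/funext => t; rewrite /sign_fun; case: ifP => _ //=; rewrite oppr0.
by rewrite /Rintegral integral0.
Qed.

Theorem lemma1p7 (R : realType) (X : hilbertType R)
  (separable : exists2 D : set X, countable D & dense D)
  (A : set (unbounded_op X)) (A0 : set (X -> X))
  (LamA : set R) (LamA_open : open LamA)
  (Lam : unbounded_op X -> (X -> X) -> set R) (pt p : \bar R)
  (A_trace : trace_compatible A A0)
  (A_standing : standing_assumption A A0 LamA Lam pt p)
  (H0 : unbounded_op X) (H0A : A H0) (V : X -> X) (VA0 : A0 V)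
  (G J : X -> X) (GV : is_abs_sqrt V G) (JV : is_sign V J)
  (h : R -> hilbertType R) (M : set (forall t, h t)) (hM : measurable_field M)
  (F0 : X -> forall t, h t) (F0_diag : diagonalizes H0 M F0)
  (Z0 : forall t, X -> h t) (HZ0 : is_Z0 H0 G F0 (Lam H0 V) Z0)
  (lam : R) (Hlam : Lam H0 V lam) :
  let T := boundary_value (T0 G H0) lam true in
  let S := scattering_matrix T J (Z0 lam) in
  meromorphic (scattering_domain T J) S /\
  forall r : R,
    pole (sandwiched_domain T J) (sandwiched_inverse T J) r%:C ->
    continues_analytically (scattering_domain T J) S r%:C.
Proof.
move=> T S.
have [_ /= cT] := sa_limits A_standing true H0A VA0 GV Hlam.
have bT := proj1 cT; have tT := tb_compact cT.
have bJ := proj1 JV.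
have [bZ _ imT] := HZ0.
split; first exact: scattering_meromorphic (bZ _ Hlam) tT.
move=> r _; apply: scattering_continues (bZ _ Hlam) tT _ (sign_form_real JV) _ => //.
exact: imT.
Qed.
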